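(* Let $\mathcal G=e^c_0-S$ and $\mathcal G^{tw}=e^c_0-S^{tw}$. (1) Let $(M,Y_M)$ be a $\Pi(0)^{1/2}\otimes F^{(2)}$-module. Then on the submodule $\overline M=\operatorname{Ker}_MQ$ we have $[\mathcal G,Y_M(v,z)]=0$ for all $v\in V^{\mathcal{SH}}(c_L,c_{L,\alpha})$. (2) Let $(M^{tw},Y_{M^{tw}})$ be a $\sigma$-twisted $\Pi(0)^{1/2}\otimes F^{(2)}$-module. Then $[\mathcal G^{tw},Y_{M^{tw}}(v,z)]=0$ for all $v\in V^{\mathcal{SH}}(c_L,c_{L,\alpha})$. Thus $\mathcal G$ (on $\overline M$) and $\mathcal G^{tw}$ (on $M^{tw}$) are screening operators, i.e. they commute with the action of $V^{\mathcal{SH}}(c_L,c_{L,\alpha})$.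
   Context: Fix $c_L,c_{L,\alpha}\in\mathbb C$ with $c_{L,\alpha}\neq0$. Let $L=\mathbb Zc+\mathbb Zd$ be the lattice with $\langle c,c\rangle=\langle d,d\rangle=0$, $\langle c,d\rangle=2$, $M(1)$ the rank two Heisenberg vertex algebra generated by $c(z),d(z)$, and $V_L=\mathbb C[L]\otimes M(1)$ the lattice vertex algebra. $\Pi(0)=\mathbb C[\mathbb Zc]\otimes M(1)\subset V_L$, and $\Pi(0)^{1/2}=\Pi(0)\oplus\Pi(0).e^{c/2}=\mathbb C[\mathbb Z\frac c2]\otimes M(1)$ is its simple current extension (a vertex algebra). $F^{(2)}$ is the fermionic vertex superalgebra generated by odd fields $\Psi^\pm(z)=\sum_{n\in\mathbb Z}\Psi^\pm(n+\frac12)z^{-n-1}$ with $\{\Psi^\pm(r),\Psi^\pm(s)\}=0$, $\{\Psi^+(r),\Psi^-(s)\}=\delta_{r+s,0}$. Put $\omega_{fer}=\frac12(\Psi^+(-\frac32)\Psi^-(-\frac12)+\Psi^-(-\frac32)\Psi^+(-\frac12)){\bf1}$. $V^{\mathcal{SH}}(c_L,c_{L,\alpha})$ (the universal $N=1$ Heisenberg-Virasoro vertex superalgebra at level zero) is realised as the vertex subalgebra of $M(1)\otimes F^{(2)}\subset\Pi(0)^{1/2}\otimes F^{(2)}$ generated by (applied to the vacuum) $\alpha=-c_{L,\alpha}c(-1)$, $\Psi=-\sqrt2\,c_{L,\alpha}\Psi^-(-\frac12)$, $\tau=\sqrt2\left(\frac12c(-1)\Psi^+(-\frac12)+\frac12d(-1)\Psi^-(-\frac12)+\frac{c_L-3}{12}\Psi^-(-\frac32)-\Psi^+(-\frac32)\right)$,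 $\omega=\frac12c(-1)d(-1)+\frac{c_L-3}{24}c(-2)-\frac12d(-2)+\omega_{fer}$. Let $a=\Psi^-(-\frac12)e^{c/2}\in\Pi(0)^{1/2}\otimes F^{(2)}$ (an odd vector). On a (untwisted) $\Pi(0)^{1/2}\otimes F^{(2)}$-module write $Y_M(a,z)=\sum_{j\in\mathbb Z}a_jz^{-j-1}$, and put $Q=a_0$ and $$S=\sum_{i=1}^\infty\frac1i\,a_{-i}a_i .$$ $\sigma=e^{\pi i d(0)}$ is an order two automorphism of $\Pi(0)^{1/2}$ (extended to $\Pi(0)^{1/2}\otimes F^{(2)}$ by acting trivially on $F^{(2)}$); $\sigma(a)=-a$ and $\sigma$ fixes $e^c$ and $V^{\mathcal{SH}}(c_L,c_{L,\alpha})$ pointwise. On a $\sigma$-twisted module write $Y_{M^{tw}}(a,z)=\sum_{j\in\frac12+\mathbb Z}a_jz^{-j-1}$ and put $$S^{tw}=\sum_{i=0}^\infty\frac1{i+\frac12}\,a_{-i-\frac12}a_{i+\frac12}.$$ In both cases $e^c_0$ is the coefficient of $z^{-1}$ in the vertex operator of $e^c$. *)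

(* Defs.v *)
From mathcomp Require Import all_boot all_order all_algebra finmap multiset.
From mathcomp Require Import boolp classical_sets fsbigop.
From mathcomp Require Import monalg.
From mathcomp Require Export reals complex.

Set Implicit Arguments.
Unset Strict Implicit.
Unset Printing Implicit Defensive.

Import Order.TTheory GRing.Theory Num.Theory.
Local Open Scope ring_scope.

(* Infinite sums are written [\sum_(j \in [set: nat]%classic) f j] and mean the
   sum over the support of [f], which is finite wherever such a sum is used
   below (modes of high index annihilate any given vector). *)

Definition gbinom (F : fieldType) (x : F) (j : nat) : F :=
  (\prod_(i < j) (x - i%:R)) / j`!%:R.

(* The data (space, vacuum, parity, n-th products u_n v) of a vertex
   superalgebra; the notions below depend on the data only. *)
Record vsa_data (F : fieldType) := VsaData {
  vsa_car :> lmodType F;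
  vsa_vac : vsa_car;
  vsa_par : bool -> vsa_car -> Prop;  (* true: odd, false: even *)
  vsa_prod : vsa_car -> int -> vsa_car -> vsa_car }.

(* [Y v n] is the coefficient of z^(-n-1) in Y_M(v,z).  No Z/2-grading of M is
   required.  The last axiom is the Jacobi identity in components (Borcherds
   identity). *)
Record is_module (F : fieldType) (V : vsa_data F) (M : lmodType F)
    (Y : V -> int -> M -> M) : Prop := IsModule {
  module_linear_l : forall n w, linear (fun v => Y v n w);
  module_linear_r : forall v n, linear (Y v n);
  module_field : forall v w, exists N : int, forall n, N <= n -> Y v n w = 0;
  module_vac : forall n w, Y (vsa_vac V) n w = if n == -1 then w else 0;
  module_borcherds : forall (pu pv : bool) (u v : V),
    vsa_par pu u -> vsa_par pv v -> forall (m n k : int) (w : M),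
    \sum_(j \in [set: nat]%classic)
       gbinom (m%:~R : F) j *: Y (vsa_prod u (n + j%:Z) v) (m + k - j%:Z) w
    = \sum_(j \in [set: nat]%classic)
       ((-1) ^+ j * gbinom (n%:~R : F) j) *:
         (Y u (m + n - j%:Z) (Y v (k + j%:Z) w)
          - ((-1) ^+ (pu && pv) * (-1) ^ n) *:
              Y v (n + k - j%:Z) (Y u (m + j%:Z) w)) }.

Definition in_coset (r : bool) (x : rat) : Prop :=
  x - (r : nat)%:R / 2%:R \is a Num.int.

(* [sigma]-twisted modules for [sigma] of order two: if sigma v = (-1)^r v then
   Y_M(v,z) has modes indexed by r/2 + Z.  As [Y v q] is linear in [v], modes of
   all vectors are indexed by [rat], those outside the coset being 0. *)
Record is_twisted_module (F : fieldType) (V : vsa_data F) (sigma : V -> V)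
    (M : lmodType F) (Y : V -> rat -> M -> M) : Prop := IsTwistedModule {
  tw_linear_l : forall q w, linear (fun v => Y v q w);
  tw_linear_r : forall v q, linear (Y v q);
  tw_field : forall v w, exists N : rat, forall q, N <= q -> Y v q w = 0;
  tw_vac : forall q w, Y (vsa_vac V) q w = if q == -1 then w else 0;
  tw_coset : forall (r : bool) (v : V), sigma v = (-1) ^+ r *: v ->
    forall q w, ~ in_coset r q -> Y v q w = 0;
  tw_borcherds : forall (pu pv ru rv : bool) (u v : V),
    vsa_par pu u -> vsa_par pv v ->
    sigma u = (-1) ^+ ru *: u -> sigma v = (-1) ^+ rv *: v ->
    forall (m k : rat) (n : int) (w : M), in_coset ru m -> in_coset rv k ->
    \sum_(j \in [set: nat]%classic)
       gbinom (ratr m : F) j *: Y (vsa_prod u (n + j%:Z) v) (m + k - j%:R) w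
    = \sum_(j \in [set: nat]%classic)
       ((-1) ^+ j * gbinom (n%:~R : F) j) *:
         (Y u (m + n%:~R - j%:R) (Y v (k + j%:R) w)
          - ((-1) ^+ (pu && pv) * (-1) ^ n) *:
              Y v (n%:~R + k - j%:R) (Y u (m + j%:R) w)) }.

(* The vertex subalgebra generated by [S]. *)
Inductive vsa_gen (F : fieldType) (V : vsa_data F) (S : V -> Prop) : V -> Prop :=
| vsa_gen_in v of S v : vsa_gen S v
| vsa_gen_vac : vsa_gen S (vsa_vac V)
| vsa_gen_lin (x : F) u v of vsa_gen S u & vsa_gen S v : vsa_gen S (x *: u + v)
| vsa_gen_prod u n v of vsa_gen S u & vsa_gen S v : vsa_gen S (vsa_prod u n v).

(* [(k, (A, B), (P, N))] stands for the basis vector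
     prod_{n in A} c(-n-1) prod_{n in B} d(-n-1)
     prod_{n in P} Psi^+(-n-1/2) prod_{n in N} Psi^-(-n-1/2) e^{kc/2},
   the products over P and N being taken with n increasing from left to
   right. *)
Notation state :=
  (int * ({mset nat}%mset * {mset nat}%mset) * ({fset nat} * {fset nat}))%type.

Inductive gen := GC | GD | Gplus | Gminus.

Definition gen_odd (g : gen) : bool :=
  match g with GC | GD => false | Gplus | Gminus => true end.

Section Fock.
Variable F : fieldType.

Local Notation Fock := {malg F[state]}.

Definition ket (s : state) : Fock := << s >>.

Definition elat (k : int) : Fock :=
  ket (k, (mset0, mset0), (fset0, fset0)).

Definition lin_ext (f : state -> Fock) (v : Fock) : Fock :=
  \sum_(s <- msupp v) v@_s *: f s.

Definition cnt_lt (n : nat) (A : {fset nat}) : nat :=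
  count (fun i => (i < n)%N) (enum_fset A).

(* Coefficient of z^(-m-1) in the field of the generator [g], on basis vectors:
   c(m), d(m), Psi^+(m+1/2), Psi^-(m+1/2).  Here [Negz n] is -n-1.  They satisfy
   [c(m),d(n)] = 2 m delta_{m+n,0}, {Psi^+_m,Psi^-_n} = delta_{m+n+1,0}, and
   c(0) = 0, d(0) = k on the sector of e^{kc/2}. *)
Definition mode_ket (g : gen) (m : int) (s : state) : Fock :=
  let: (k, (A, B), (P, N)) := s in
  match g, m with
  | GC, Negz n => ket (k, ((n +` A)%mset, B), (P, N))
  | GC, Posz 0 => 0
  | GC, Posz n.+1 =>
      (2 * n.+1 * B n)%N%:R *: ket (k, (A, (B `\ n)%mset), (P, N))
  | GD, Negz n => ket (k, (A, (n +` B)%mset), (P, N))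
  | GD, Posz 0 => k%:~R *: ket s
  | GD, Posz n.+1 =>
      (2 * n.+1 * A n)%N%:R *: ket (k, ((A `\ n)%mset, B), (P, N))
  | Gplus, Negz n =>
      if n \in P then 0
      else (-1) ^+ cnt_lt n P *: ket (k, (A, B), ((n |` P)%fset, N))
  | Gplus, Posz n =>
      if n \in N then
        (-1) ^+ (#|` P| + cnt_lt n N) *: ket (k, (A, B), (P, (N `\ n)%fset))
      else 0
  | Gminus, Negz n =>
      if n \in N then 0
      else (-1) ^+ (#|` P| + cnt_lt n N) *: ket (k, (A, B), (P, (n |` N)%fset))
  | Gminus, Posz n =>
      if n \in P then (-1) ^+ cnt_lt n P *: ket (k, (A, B), ((P `\ n)%fset, N))
      else 0
  end.

Definition mode (g : gen) (m : int) : Fock -> Fock := lin_ext (mode_ket g m).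

(* Coefficient of z^n in (sum_{i >= 1} t_i z^i)^m and in
   exp (sum_{i >= 1} t_i z^i), for operators t_i. *)
Fixpoint serpow (t : nat -> Fock -> Fock) (m n : nat) (w : Fock) : Fock :=
  if m is m'.+1 then \sum_(1 <= i < n.+1) t i (serpow t m' (n - i)%N w)
  else if n == 0%N then w else 0.

Definition serexp (t : nat -> Fock -> Fock) (n : nat) (w : Fock) : Fock :=
  \sum_(m < n.+1) (m`!%:R)^-1 *: serpow t m n w.

(* The mode of z^(-m-1) in
   Y(e^{kc/2},z) = e^{kc/2} exp(sum_{i>0} (k/2) c(-i) z^i / i)
                            exp(- sum_{i>0} (k/2) c(i) z^(-i) / i);
   the factor z^{k c(0)/2} and the cocycle are trivial since <c,c> = 0. *)
Definition lat_shift (k : int) : Fock -> Fock :=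
  lin_ext (fun s => let: (l, AB, PN) := s in ket (k + l, AB, PN)).

Definition lat_cre (k : int) (i : nat) (w : Fock) : Fock :=
  (k%:~R / (2 * i)%:R) *: mode GC (- i%:Z) w.

Definition lat_ann (k : int) (i : nat) (w : Fock) : Fock :=
  (- (k%:~R / (2 * i)%:R)) *: mode GC i%:Z w.

Definition lat_mode (k m : int) (w : Fock) : Fock :=
  \sum_(q \in [set: nat]%classic)
     (if q%:Z - m - 1 is Posz p
      then lat_shift k (serexp (lat_cre k) p (serexp (lat_ann k) q w)) else 0).

(* Modes of the divided derivative (d/dz)^n A(z) / n!. *)
Definition dder (n : nat) (A : int -> Fock -> Fock) (m : int) (w : Fock) : Fock :=
  ((-1) ^+ n * gbinom (m%:~R : F) n) *: A (m - n%:Z) w.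

(* Modes of the normally ordered product :A(z)B(z):, [s] telling whether both
   fields are odd. *)
Definition nop (s : bool) (A B : int -> Fock -> Fock) (m : int) (w : Fock) : Fock :=
  \sum_(j \in [set: nat]%classic) A (- j%:Z - 1) (B (m + j%:Z) w)
  + (-1) ^+ s *: \sum_(j \in [set: nat]%classic) B (m - j%:Z - 1) (A j%:Z w).

Fixpoint word_mode (k : int) (l : seq (gen * nat)) : int -> Fock -> Fock :=
  if l is (g, n) :: l' then
    nop (gen_odd g && odd (count (fun x => gen_odd x.1) l'))
        (dder n (mode g)) (word_mode k l')
  else lat_mode k.

(* Y of a basis vector: the iterated normally ordered product of the divided
   derivatives of the generating fields and of Y(e^{kc/2},z), in the order of
   the creation operators in that vector. *)
Definition state_mode (s : state) : int -> Fock -> Fock :=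
  let: (k, (A, B), (P, N)) := s in
  word_mode k ([seq (GC, n) | n <- enum_mset A] ++ [seq (GD, n) | n <- enum_mset B]
    ++ [seq (Gplus, n) | n <- sort leq (enum_fset P)]
    ++ [seq (Gminus, n) | n <- sort leq (enum_fset N)]).

Definition Fock_prod (v : Fock) (n : int) (w : Fock) : Fock :=
  lin_ext (fun s => state_mode s n w) v.

Definition state_odd (s : state) : bool := odd (#|` s.2.1| + #|` s.2.2|).

Definition Fock_par (p : bool) (v : Fock) : Prop :=
  forall s, s \in msupp v -> state_odd s = p.

Definition PiF2 : vsa_data F := VsaData (elat 0) Fock_par Fock_prod.

(* e^{pi i d(0)}: d(0) acts on the sector of e^{kc/2} by k. *)
Definition sigma : PiF2 -> PiF2 := lin_ext (fun s => (-1) ^ s.1.1 *: ket s).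

Definition vec_a : PiF2 := mode Gminus (-1) (elat 1).
Definition vec_ec : PiF2 := elat 2.

Definition opQ (M : lmodType F) (Y : PiF2 -> int -> M -> M) : M -> M :=
  Y vec_a 0.

Definition opS (M : lmodType F) (Y : PiF2 -> int -> M -> M) (w : M) : M :=
  \sum_(i \in [set i : nat | (1 <= i)%N]%classic)
     (i%:R)^-1 *: Y vec_a (- i%:Z) (Y vec_a i%:Z w).

Definition opG (M : lmodType F) (Y : PiF2 -> int -> M -> M) (w : M) : M :=
  Y vec_ec 0 w - opS Y w.

Definition opS_tw (M : lmodType F) (Y : PiF2 -> rat -> M -> M) (w : M) : M :=
  \sum_(i \in [set: nat]%classic)
     (i%:R + 2%:R^-1)^-1 *: Y vec_a (- i%:R - 2%:R^-1) (Y vec_a (i%:R + 2%:R^-1) w).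

Definition opG_tw (M : lmodType F) (Y : PiF2 -> rat -> M -> M) (w : M) : M :=
  Y vec_ec 0 w - opS_tw Y w.

End Fock.

Section SH.
Variables (C : numClosedFieldType) (cL cLa : C).

Local Notation vac := (elat C 0).
Local Notation c := (mode (F := C) GC).
Local Notation d := (mode (F := C) GD).
(* Psi^+(m+1/2) and Psi^-(m+1/2) *)
Local Notation psip := (mode (F := C) Gplus).
Local Notation psim := (mode (F := C) Gminus).

Definition vec_alpha : PiF2 C := (- cLa) *: c (-1) vac.

Definition vec_Psi : PiF2 C := (- (sqrtC 2%:R * cLa)) *: psim (-1) vac.

Definition vec_tau : PiF2 C :=
  sqrtC 2%:R *: (2%:R^-1 *: c (-1) (psip (-1) vac)
                 + 2%:R^-1 *: d (-1) (psim (-1) vac)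
                 + ((cL - 3%:R) / 12%:R) *: psim (-2) vac
                 - psip (-2) vac).

Definition vec_omega_fer : PiF2 C :=
  2%:R^-1 *: (psip (-2) (psim (-1) vac) + psim (-2) (psip (-1) vac)).

Definition vec_omega : PiF2 C :=
  2%:R^-1 *: c (-1) (d (-1) vac) + ((cL - 3%:R) / 24%:R) *: c (-2) vac
  - 2%:R^-1 *: d (-2) vac + vec_omega_fer.

Definition VSH : PiF2 C -> Prop :=
  vsa_gen (fun v => [\/ v = vec_alpha, v = vec_Psi, v = vec_tau | v = vec_omega]).

End SH.

(* Main.v *)
(* Write b = e^{c/2} and r for the (positive) mode indices of a that occur in S.
   Borcherds' commutator formula reduces everything to the products a_j v, j >= 0,
   and e^c_0 v with v one of the four generators.  All of them vanish except
   a_1 tau = -sqrt2 b, a_1 omega = a and e^c_0 tau = -sqrt2 a_{-1} b.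
   Hence [S, tau_k] = -sqrt2 sum_r (a_{-r} b_{r+k-1} + b_{-r+k-1} a_r), which by
   the Borcherds identity for (a_{-1} b)_k is [e^c_0, tau_k] up to the term
   b_{k-1} a_0, zero on Ker Q.  Likewise
   [S, omega_k] = sum_r (a_{-r} a_{r+k-1} - a_{-r+k-1} a_r) is, up to a_0, a sum
   over all modes of a family that is antisymmetric because the modes of a
   anticommute, and so vanishes.  The commutant of G on Ker Q is closed under all
   n-th products. *)

Require Import Defs.
From mathcomp Require Import all_boot all_order all_algebra finmap multiset.
From mathcomp Require Import boolp classical_sets fsbigop.
From mathcomp Require Import monalg.
From mathcomp Require Import zify ring lra.
Set Implicit Arguments.
Unset Strict Implicit.
Unset Printing Implicit Defensive.

Import Order.TTheory GRing.Theory Num.Theory.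
Local Open Scope ring_scope.

(** The weights 1/i and 1/(i+1/2) in S come from the fact that, for v a generator, a_j v with j >= 0
    can be nonzero only at j = 1: the commutator of a_r with v_k then carries exactly the factor r.
    Both parts of the theorem are one argument on modes indexed by rationals, [ra] recording whether
    vectors of odd charge have modes in Z or in 1/2 + Z. In the twisted case a has no mode of index
    0, so a_0 = 0 and the kernel condition holds for every w; but the modes of a_{-1} b can then no
    longer be read off from the Borcherds identity at m = 0. Two obstacles shape the induction over
    V^SH. Commutation with G holds only on Ker Q, so it passes to products only when proved together
    with the stability of Ker Q. And the Borcherds identity is given for vectors of definite parity,
    while the generated subalgebra contains mixed ones, so each element is carried along with its
    even and odd parts. Infinite sums have the default value 0 on infinite support, hence the many
    truncation bounds. *)

Section FiniteSums.
Variable (V : zmodType).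

Lemma fsum_nat_trunc (f : nat -> V) N : (forall j, (N <= j)%N -> f j = 0) ->
  \sum_(j \in [set: nat]%classic) f j = \sum_(j < N) f j.
Proof.
move=> f0; rewrite fsbig_ord; apply/esym/fsbig_widen => //= j [_ /negP].
by rewrite -leqNgt => /f0.
Qed.

Lemma fsum_single (f : nat -> V) i : (forall j, j != i -> f j = 0) ->
  \sum_(j \in [set: nat]%classic) f j = f i.
Proof.
move=> f0; rewrite (@fsum_nat_trunc f i.+1); last first.
  by move=> j lt; apply: f0; rewrite neq_ltn lt orbT.
rewrite big_ord_recr /= big1 ?add0r // => j _.
by apply: f0; rewrite neq_ltn ltn_ord.
Qed.

Lemma fsum0 (f : nat -> V) : (forall j, f j = 0) ->
  \sum_(j \in [set: nat]%classic) f j = 0.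
Proof. by move=> f0; rewrite fsbig1. Qed.

End FiniteSums.

Section LinearMaps.
Variables (F : nzRingType) (U V : lmodType F) (f : U -> V).
Hypothesis lf : linear f.

Lemma linD u v : f (u + v) = f u + f v.
Proof. by rewrite -[u]scale1r lf !scale1r. Qed.

Lemma lin0 : f 0 = 0.
Proof. by apply: (addrI (f 0)); rewrite -linD !addr0. Qed.

Lemma linZ a u : f (a *: u) = a *: f u.
Proof. by rewrite -[a *: u]addr0 lf lin0 addr0. Qed.

Lemma linN u : f (- u) = - f u.
Proof. by rewrite -scaleN1r linZ scaleN1r. Qed.

Lemma linB u v : f (u - v) = f u - f v.
Proof. by rewrite linD linN. Qed.

Lemma lin_sum I (r : seq I) (P : pred I) (g : I -> U) :
  f (\sum_(i <- r | P i) g i) = \sum_(i <- r | P i) f (g i).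
Proof. by rewrite (big_morph f linD lin0). Qed.

End LinearMaps.

Lemma lin_comp (F : nzRingType) (U V W : lmodType F) (f : V -> W) (g : U -> V) :
  linear f -> linear g -> linear (f \o g).
Proof. by move=> lf lg a u v; rewrite /= lg lf. Qed.

(** The vanishing bound at each vector protects additivity: a sum with infinite support would
    silently take the value 0. *)
Lemma lin_fsum (F : nzRingType) (U V : lmodType F) (g : nat -> U -> V) :
  (forall j, linear (g j)) ->
  (forall u, exists N, forall j, (N <= j)%N -> g j u = 0) ->
  linear (fun u => \sum_(j \in [set: nat]%classic) g j u).
Proof.
move=> lg tg a u v; have [N gu] := tg u; have [N' gv] := tg v.
pose K := maxn N N'.
have gu' j : (K <= j)%N -> g j u = 0.
  by move=> le; apply/gu/(leq_trans _ le)/leq_maxl.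
have gv' j : (K <= j)%N -> g j v = 0.
  by move=> le; apply/gv/(leq_trans _ le)/leq_maxr.
rewrite (fsum_nat_trunc gu') (fsum_nat_trunc gv') (@fsum_nat_trunc _ _ K).
  by rewrite scaler_sumr -big_split /=; apply: eq_bigr => j _; rewrite lg.
by move=> j le; rewrite lg gu' // gv' // scaler0 addr0.
Qed.

(** * Support conditions on Fock vectors and linear extension from basis states *)

Section Support.
Variable F : fieldType.
Local Notation Fock := {malg F[state]}.

Definition supported (P : state -> Prop) (v : Fock) : Prop :=
  forall s, s \in msupp v -> P s.

Lemma supported0 P : supported P 0.
Proof. by move=> s; rewrite msupp0 inE. Qed.

Lemma supportedD P u v : supported P u -> supported P v -> supported P (u + v).
Proof.
move=> Pu Pv s /(fsubsetP (msuppD_le u v)); rewrite inE.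
by case/orP => [/Pu|/Pv].
Qed.

Lemma supportedZ P a v : supported P v -> supported P (a *: v).
Proof. by move=> Pv s /(fsubsetP (msuppZ_le a v)) /Pv. Qed.

Lemma supportedN P v : supported P v -> supported P (- v).
Proof. by rewrite -scaleN1r; apply: supportedZ. Qed.

Lemma supported_sum P (I : eqType) (r : seq I) (f : I -> Fock) :
  (forall i, i \in r -> supported P (f i)) -> supported P (\sum_(i <- r) f i).
Proof.
move=> Pf; rewrite big_seq; apply: (big_ind (supported P)) => //.
  exact: supported0.
exact: supportedD.
Qed.

Lemma supported_fsum P (I : choiceType) (D : set I) (f : I -> Fock) :
  (forall i, supported P (f i)) -> supported P (\sum_(i \in D) f i).
Proof. by move=> Pf; apply: supported_sum => i _; apply: Pf. Qed.

Lemma supported_ket (P : state -> Prop) s : P s -> supported P (ket F s).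
Proof. by move=> Ps s'; rewrite msuppU oner_eq0 inE => /eqP->. Qed.

Lemma supportedW (P Q : state -> Prop) v :
  (forall s, P s -> Q s) -> supported P v -> supported Q v.
Proof. by move=> PQ Pv s /Pv /PQ. Qed.

Lemma supported_False v : supported (fun=> False) v -> v = 0.
Proof.
move=> v0; apply/malgP => s; rewrite mcoeff0 mcoeff_outdom //.
by apply/negP => /v0.
Qed.

(** Linearity of [lin_ext] compares sums over three different supports; a common finite index set
    makes them comparable term by term. *)
Lemma lin_ext_widen (f : state -> Fock) (d : {fset state}) v :
  (msupp v `<=` d)%fset -> lin_ext f v = \sum_(s <- d) v@_s *: f s.
Proof.
move=> le; rewrite /lin_ext; apply: big_fset_incl => // s _ sN.
by rewrite mcoeff_outdom // scale0r.
Qed.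

Lemma lin_ext_linear (f : state -> Fock) : linear (lin_ext f).
Proof.
move=> a u v; set d := (msupp u `|` msupp v)%fset.
have le : (msupp (a *: u + v) `<=` d)%fset.
  apply: fsubset_trans (msuppD_le _ _) _; apply: fsetUSS => //.
  exact: msuppZ_le.
rewrite (lin_ext_widen f le) (@lin_ext_widen f d u) ?fsubsetUl //.
rewrite (@lin_ext_widen f d v) ?fsubsetUr // scaler_sumr -big_split /=.
by apply: eq_bigr => s _; rewrite mcoeffD mcoeffZ scalerDl scalerA.
Qed.

Lemma lin_ext_ket f s : lin_ext f (ket F s) = f s.
Proof.
by rewrite /lin_ext msuppU oner_eq0 big_seq_fset1 mcoeffUU scale1r.
Qed.

Lemma supported_lin_ext (P Q : state -> Prop) f v : supported P v ->
  (forall s, P s -> supported Q (f s)) -> supported Q (lin_ext f v).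
Proof.
by move=> Pv PQ; apply: supported_sum => s /Pv /PQ; apply: supportedZ.
Qed.

Lemma lin_ext_trunc (f : nat -> state -> Fock) :
  (forall s, exists N, forall n, (N <= n)%N -> f n s = 0) ->
  forall v, exists N, forall n, (N <= n)%N -> lin_ext (f n) v = 0.
Proof.
move=> tf v; rewrite /lin_ext; elim: (enum_fset (msupp v)) => [|s r [N IH]].
  by exists 0%N => n _; rewrite big_nil.
have [N' fs] := tf s; exists (maxn N N') => n; rewrite geq_max => /andP[le le'].
by rewrite big_cons IH // fs // scaler0 addr0.
Qed.

End Support.

(** * Fields on the Fock space *)

Section FieldOperators.
Variable F : fieldType.
Local Notation Fock := {malg F[state]}.

(** A field in the vertex algebra sense: A(z)v is a formal Laurent series for every v. Truncation is
    what keeps the sums in [nop] finite, and so linear. *)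
Record field_op (A : int -> Fock -> Fock) : Prop := FieldOp {
  field_op_linear : forall m, linear (A m);
  field_op_trunc : forall v, exists N : nat, forall m : int, N%:Z <= m -> A m v = 0 }.

Lemma seq_nat_bound (r : seq nat) : exists N, forall n, (N <= n)%N -> n \notin r.
Proof.
elim: r => [|x r [N IH]]; first by exists 0%N.
exists (maxn x.+1 N) => n; rewrite geq_max => /andP[lt /IH nr].
by rewrite inE negb_or nr gtn_eqF.
Qed.

Lemma mode_ket_trunc g s :
  exists N, forall n, (N <= n)%N -> mode_ket F g (Posz n) s = 0.
Proof.
case: s => [[k [A B]] [P N]]; case: g.
- have [K HK] := seq_nat_bound B; exists K.+1 => -[|n] //= /HK.
  by rewrite in_mset -leqNgt leqn0 => /eqP->; rewrite muln0 scale0r.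
- have [K HK] := seq_nat_bound A; exists K.+1 => -[|n] //= /HK.
  by rewrite in_mset -leqNgt leqn0 => /eqP->; rewrite muln0 scale0r.
- have [K HK] := seq_nat_bound N; exists K => n /= /HK nN.
  by rewrite ifN.
- have [K HK] := seq_nat_bound P; exists K => n /= /HK nN.
  by rewrite ifN.
Qed.

Lemma field_op_mode g : field_op (@mode F g).
Proof.
split=> [m|v]; first exact: lin_ext_linear.
have [N HN] := lin_ext_trunc (mode_ket_trunc g) v.
by exists N => -[m|//] le; apply: HN.
Qed.

Lemma mode_linear g m : linear (@mode F g m).
Proof. exact: (field_op_linear (field_op_mode g)). Qed.

Lemma field_op_dder n A : field_op A -> field_op (dder n A).
Proof.
move=> [lA tA]; split=> [m a u v|v].
  by rewrite /dder lA scalerDr !scalerA [a * _]mulrC.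
have [N HN] := tA v; exists (N + n)%N => m le.
by rewrite /dder HN ?scaler0 // lerBrDr -PoszD.
Qed.

Lemma field_op_nop s A B : field_op A -> field_op B -> field_op (nop s A B).
Proof.
move=> [lA tA] [lB tB]; split=> [m a u v|v].
  rewrite /nop.
  have l1 : linear (fun w => \sum_(j \in [set: nat]%classic)
                        A (- j%:Z - 1) (B (m + j%:Z) w)).
    apply: lin_fsum => [j x y z|w]; first by rewrite lB lA.
    (* This choice gives m + j >= N whatever the sign of m. *)
    have [N HN] := tB w; exists (N + `|m|)%N => j le.
    rewrite HN ?(lin0 (lA _)) // addrC -lerBlDr.
    apply: le_trans (_ : (N + `|m|)%N%:Z <= _); last by rewrite lez_nat.
    by rewrite PoszD lerD2l abszE -normrN ler_norm.
  have l2 : linear (fun w => \sum_(j \in [set: nat]%classic)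
                        B (m - j%:Z - 1) (A j%:Z w)).
    apply: lin_fsum => [j x y z|w]; first by rewrite lA lB.
    have [N HN] := tA w; exists N => j le.
    by rewrite HN ?(lin0 (lB _)).
  by rewrite l1 l2 !scalerDr !scalerA [_ * a]mulrC addrACA.
have [N HN] := tA v; have [N' HN'] := tB v.
(* Only the finitely many vectors A_j v with j < N can be nonzero, so their truncation bounds for B,
   shifted by j + 1, have a common upper bound. *)
have [K HK] : exists K : nat, forall j, (j < N)%N -> forall m : int, K%:Z <= m ->
    B (m - j%:Z - 1) (A j%:Z v) = 0.
  elim: N {HN} => [|N [K IH]]; first by exists 0%N.
  have [K' HK'] := tB (A N%:Z v); exists (maxn K (K' + N + 1)) => j.
  rewrite ltnS leq_eqVlt => /predU1P[->|lt] m le.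
    apply: HK'; rewrite -addrA -opprD lerBrDr.
    apply: le_trans le; rewrite -!PoszD lez_nat addnA; exact: leq_maxr.
  by apply: IH => //; apply: le_trans le; rewrite lez_nat leq_maxl.
exists (maxn K N') => m le; rewrite /nop !fsum0 ?scaler0 ?addr0 // => j.
  have [lt|le'] := ltnP j N; last by rewrite HN ?(lin0 (lB _)).
  by apply: HK => //; apply: le_trans le; rewrite lez_nat leq_maxl.
rewrite HN' ?(lin0 (lA _)) //; apply: (@le_trans _ _ m); last by rewrite lerDl.
by apply: le_trans le; rewrite lez_nat leq_maxr.
Qed.

(* The positive modes of c lower this weight, so that exp of the annihilation
   part of Y(e^{kc/2},z) is a finite sum on every vector. *)
Definition dweight (s : state) : nat := \sum_(n <- s.1.2.2) n.+1.

Lemma big_msetB1 (B : {mset nat}%mset) n (f : nat -> nat) : n \in B ->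
  (\sum_(i <- B) f i = f n + \sum_(i <- (B `\ n)%mset) f i)%N.
Proof.
move=> nB; rewrite (perm_big (n :: (B `\ n)%mset)) ?big_cons //.
apply/allP => i _; rewrite /= !count_mem_mset -{1}(msetB1K nB) mset1DE.
by rewrite [n == i]eq_sym.
Qed.

(** The number [e] is the total degree already spent. Since c(i) removes a factor d(-i), of weight
    i, what the weight loses is added to [e]. *)
Lemma dweight_lat_ann k i e D w : (1 <= i)%N ->
  supported (fun s => dweight s + e <= D)%N w ->
  supported (fun s => dweight s + (i + e) <= D)%N (@lat_ann F k i w).
Proof.
case: i => // n _ Hw; apply: supportedZ; apply: supported_lin_ext Hw _.
move=> [[l [A B]] [P N]] /= le.
case: (boolP (n \in B)) => [nB|]; last first.
  rewrite in_mset -leqNgt leqn0 => /eqP->; rewrite muln0 scale0r.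
  exact: supported0.
apply: supportedZ; apply: supported_ket; move: le; rewrite /dweight /= (big_msetB1 _ nB).
by rewrite addnA [(_ + n.+1)%N]addnC.
Qed.

(** The condition [P] may depend on the accumulated degree. A degree-dependent weight bound gives
    the truncation of the annihilation part, a constant [P] gives the preservation of charge and
    parity. *)
Lemma serpow_supported (P : nat -> state -> Prop) (t : nat -> Fock -> Fock) :
  (forall i e w, (1 <= i)%N -> supported (P e) w -> supported (P (i + e)%N) (t i w)) ->
  forall m n e w, supported (P e) w -> supported (P (n + e)%N) (serpow t m n w).
Proof.
move=> tP; elim=> [|m IH] n e w Pw /=.
  by case: n => [|n] //; apply: supported0.
apply: supported_sum => i; rewrite mem_index_iota ltnS => /andP[i1 le].
rewrite -(subnKC le) -addnA; apply: tP => //; rewrite addKn; exact: IH.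
Qed.

Lemma serexp_supported (P : nat -> state -> Prop) (t : nat -> Fock -> Fock) :
  (forall i e w, (1 <= i)%N -> supported (P e) w -> supported (P (i + e)%N) (t i w)) ->
  forall n e w, supported (P e) w -> supported (P (n + e)%N) (serexp t n w).
Proof.
move=> tP n e w Pw; apply: supported_sum => m _; apply: supportedZ.
exact: serpow_supported.
Qed.

Lemma serexp_lat_ann_trunc k w :
  exists N, forall q, (N <= q)%N -> serexp (@lat_ann F k) q w = 0.
Proof.
pose D := (\max_(s <- msupp w) dweight s)%N; exists D.+1 => q lt.
apply: supported_False.
apply: (@supportedW _ (fun s => dweight s + (q + 0) <= D)%N).
  move=> s; rewrite addn0 => /(leq_trans (leq_addl _ _)).
  by rewrite leqNgt lt.
apply: (@serexp_supported (fun e s => dweight s + e <= D)%N).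
  move=> i e v i1; exact: dweight_lat_ann.
by move=> s ss; rewrite addn0; apply: leq_bigmax_seq.
Qed.

Lemma serpow_linear (t : nat -> Fock -> Fock) m n :
  (forall i, linear (t i)) -> linear (serpow t m n).
Proof.
move=> lt; elim: m n => [|m IH] n a u v /=.
  by case: eqP => // _; rewrite scaler0 addr0.
rewrite scaler_sumr -big_split; apply: eq_bigr => i _ /=.
by rewrite IH lt.
Qed.

Lemma serexp_linear (t : nat -> Fock -> Fock) n :
  (forall i, linear (t i)) -> linear (serexp t n).
Proof.
move=> lt a u v; rewrite scaler_sumr -big_split; apply: eq_bigr => i _ /=.
by rewrite serpow_linear // scalerDr !scalerA [a * _]mulrC.
Qed.

Lemma lat_ann_linear k i : linear (@lat_ann F k i).
Proof.
by move=> a u v; rewrite /lat_ann mode_linear scalerDr !scalerA [a * _]mulrC.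
Qed.

Lemma lat_cre_linear k i : linear (@lat_cre F k i).
Proof.
by move=> a u v; rewrite /lat_cre mode_linear scalerDr !scalerA [a * _]mulrC.
Qed.

Lemma serexp_lat_ann_linear k q : linear (serexp (@lat_ann F k) q).
Proof. by apply: serexp_linear => i; apply: lat_ann_linear. Qed.

Lemma serexp_lat_cre_linear k q : linear (serexp (@lat_cre F k) q).
Proof. by apply: serexp_linear => i; apply: lat_cre_linear. Qed.

Lemma lat_shift_linear k : linear (@lat_shift F k).
Proof. exact: lin_ext_linear. Qed.

Lemma field_op_lat_mode k : field_op (@lat_mode F k).
Proof.
have shift0 p w : w = 0 ->
    lat_shift k (serexp (@lat_cre F k) p w) = 0.
  by move=> ->; apply: lin0 (lin_comp (lat_shift_linear k) (serexp_lat_cre_linear k p)).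
split=> [m|v].
  apply: lin_fsum => [q a u v|v].
    case: (_ - _ - _) => p; last by rewrite scaler0 addr0.
    exact: (lin_comp (lat_shift_linear k)
      (lin_comp (serexp_lat_cre_linear k p) (serexp_lat_ann_linear k q))).
  have [N HN] := serexp_lat_ann_trunc k v; exists N => q le.
  by case: (_ - _ - _) => p //; rewrite shift0 // HN.
have [N HN] := serexp_lat_ann_trunc k v; exists N => m le.
rewrite /lat_mode fsum0 // => q.
have [lt|le'] := ltnP q N; last first.
  by case: (_ - _ - _) => p //; rewrite shift0 // HN.
(* With q < N <= m this exponent is negative, and the creation part has no negative powers. *)
have : q%:Z - m - 1 < 0.
  rewrite subr_lt0; apply: (@lt_trans _ _ 0) => //.
  by rewrite subr_lt0; apply: lt_le_trans le; rewrite ltz_nat.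
by case: (_ - _ - _).
Qed.

Lemma field_op_word_mode k l : field_op (@word_mode F k l).
Proof.
elim: l => [|[g n] l IH] /=; first exact: field_op_lat_mode.
by apply: field_op_nop => //; apply: field_op_dder; apply: field_op_mode.
Qed.

Lemma Fock_prod_linear_l n w : linear (fun v : Fock => Fock_prod v n w).
Proof. exact: lin_ext_linear. Qed.

Lemma Fock_prod_linear_r (v : Fock) n : linear (Fock_prod v n).
Proof.
move=> a u w; rewrite /Fock_prod /lin_ext scaler_sumr -big_split /=.
apply: eq_bigr => -[[k [A B]] [P N]] _.
rewrite /state_mode (field_op_linear (field_op_word_mode _ _)).
by rewrite scalerDr !scalerA [a * _]mulrC.
Qed.

End FieldOperators.

(** * The bigrading of the Fock space by charge and parity *)

Section Grading.
Variable F : fieldType.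
Local Notation Fock := {malg F[state]}.

(** The charge k is the eigenvalue of d(0) and later selects the coset of modes in a twisted module;
    the parity selects the sign in the Borcherds identity. The zero vector has every degree. *)
Definition graded (k : int) (p : bool) : Fock -> Prop :=
  supported (fun s => s.1.1 = k /\ state_odd s = p).

Definition shifts (k : int) (p : bool) (f : Fock -> Fock) : Prop :=
  forall l q v, graded l q v -> graded (k + l) (p (+) q) (f v).

Lemma shifts_lin_ext k p (f : state -> Fock) :
  (forall s, graded (k + s.1.1) (p (+) state_odd s) (f s)) -> shifts k p (lin_ext f).
Proof.
move=> Hf l q v Hv; apply: supported_lin_ext Hv _ => s [<- <-]; exact: Hf.
Qed.

Lemma shifts_mode g m : shifts 0 (gen_odd g) (@mode F g m).
Proof.
apply: shifts_lin_ext => -[[k [A B]] [P N]]; rewrite /state_odd /= add0r.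
case: g; case: m => [[|n]|n] //=; try case: ifP => //= nP; try exact: supported0;
  try (apply: supportedZ); apply: supported_ket; rewrite /state_odd //=; split => //.
- by rewrite (cardfsD1 0%N N) nP add1n addnS /= negbK.
- by rewrite (cardfsD1 n.+1 N) nP add1n addnS /= negbK.
- by rewrite cardfsU1 nP.
- by rewrite (cardfsD1 0%N P) nP add1n addSn /= negbK.
- by rewrite (cardfsD1 n.+1 P) nP add1n addSn /= negbK.
- by rewrite cardfsU1 nP add1n addnS.
Qed.

Lemma shifts_comp k p f l q g : shifts k p f -> shifts l q g ->
  shifts (k + l) (p (+) q) (f \o g).
Proof.
move=> Hf Hg i r v Hv; rewrite -addrA -addbA; apply: Hf; exact: Hg.
Qed.

Lemma shifts_scale k p f a : shifts k p f -> shifts k p (fun v => a *: f v).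
Proof. by move=> Hf l q v /Hf; apply: supportedZ. Qed.

Lemma shifts_fsum k p (f : nat -> Fock -> Fock) : (forall j, shifts k p (f j)) ->
  shifts k p (fun v => \sum_(j \in [set: nat]%classic) f j v).
Proof. by move=> Hf l q v Hv; apply: supported_fsum => j; apply: Hf. Qed.

Lemma shifts_serexp (t : nat -> Fock -> Fock) n :
  (forall i, shifts 0 false (t i)) -> shifts 0 false (serexp t n).
Proof.
move=> Ht l q v Hv; rewrite add0r.
apply: (@serexp_supported _ (fun _ s => s.1.1 = l /\ state_odd s = q) _ _ n 0%N) => //.
by move=> i e w _ /(Ht i); rewrite add0r.
Qed.

Lemma shifts_lat_mode k m : shifts k false (@lat_mode F k m).
Proof.
apply: shifts_fsum => q; case: (_ - _ - _) => p; last first.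
  by move=> *; apply: supported0.
have h0 : shifts k false (@lat_shift F k).
  by apply: shifts_lin_ext => -[[l AB] PN]; apply: supported_ket; rewrite addrC.
have h1 : shifts 0 false (serexp (@lat_cre F k) p).
  by apply: shifts_serexp => i; apply: shifts_scale; apply: shifts_mode.
have h2 : shifts 0 false (serexp (@lat_ann F k) q).
  by apply: shifts_serexp => i; apply: shifts_scale; apply: shifts_mode.
by move: (shifts_comp h0 (shifts_comp h1 h2)); rewrite !addr0.
Qed.

Lemma shifts_nop k p l q s A B :
  (forall m, shifts k p (A m)) -> (forall m, shifts l q (B m)) ->
  forall m, shifts (k + l) (p (+) q) (nop s A B m).
Proof.
move=> HA HB m i r v Hv; apply: supportedD.
  apply: supported_fsum => j; exact: (shifts_comp (HA _) (HB _)).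
apply: supportedZ; apply: supported_fsum => j.
rewrite [k + l]addrC [p (+) q]addbC; exact: (shifts_comp (HB _) (HA _)).
Qed.

Lemma shifts_word_mode k l m :
  shifts k (odd (count (fun x => gen_odd x.1) l)) (@word_mode F k l m).
Proof.
elim: l m => [|[g n] l IH] m /=; first exact: shifts_lat_mode.
rewrite -[X in shifts X]add0r oddD oddb; apply: shifts_nop => // {}m.
by apply: shifts_scale; apply: shifts_mode.
Qed.

Lemma graded_Fock_prod k p l q u n v :
  graded k p u -> graded l q v -> graded (k + l) (p (+) q) (Fock_prod u n v).
Proof.
move=> Hu Hv; apply: supported_lin_ext Hu _ => -[[i [A B]] [P N]] /= [<- <-].
have := @shifts_word_mode i ([seq (GC, n) | n <- enum_mset A] ++ [seq (GD, n) | n <- enum_mset B]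
    ++ [seq (Gplus, n) | n <- sort leq (enum_fset P)]
    ++ [seq (Gminus, n) | n <- sort leq (enum_fset N)]) n l q v Hv.
have cst g (r : seq nat) : count (fun x => gen_odd x.1) [seq (g, n) | n <- r]
    = if gen_odd g then size r else 0%N.
  rewrite count_map; case E : (gen_odd g).
    by rewrite -count_predT; apply: eq_count => x /=; rewrite E.
  by rewrite -(count_pred0 r); apply: eq_count => x /=; rewrite E.
by rewrite !count_cat !cst /= !size_sort.
Qed.

Lemma graded_par k p v : graded k p v -> Fock_par p v.
Proof. by move=> Hv s /Hv []. Qed.

End Grading.

Lemma seq_fset0 (T : choiceType) : enum_fset (fset0 : {fset T}) = [::].
Proof. by apply: size0nil; apply: cardfs0. Qed.

Lemma seq_fset1 (T : choiceType) (x : T) : enum_fset [fset x]%fset = [:: x].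
Proof.
apply: perm_small_eq => //; apply: uniq_perm => //= y.
by rewrite !inE.
Qed.

(** * Products with a and with lattice vectors *)

Section LatticeModes.
Variable F : numFieldType.
Local Notation Fock := {malg F[state]}.
Local Notation K k A B P N := (ket F (k, (A%mset, B%mset), (P%fset, N%fset))).

Lemma mode_ketE g m s : mode g m (ket F s) = mode_ket F g m s.
Proof. exact: lin_ext_ket. Qed.

(* [lat_coef k z w] is the coefficient of x^z in the creation part of
   Y(e^{kc/2},x) applied to w. *)
Definition lat_coef (k z : int) (w : Fock) : Fock :=
  if z is Posz p then lat_shift k (serexp (lat_cre k) p w) else 0.

Lemma lat_coef_linear k z : linear (lat_coef k z).
Proof.
case: z => [p|p] a u v; last by rewrite /= scaler0 addr0.
exact: (lin_comp (lat_shift_linear k) (serexp_lat_cre_linear k p)).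
Qed.

Lemma serpowS (t : nat -> Fock -> Fock) m n w :
  serpow t m.+1 n w = \sum_(1 <= i < n.+1) t i (serpow t m (n - i)%N w).
Proof. by []. Qed.

(** Each term of the four generators contains at most one d, and each annihilation operator of
    e^{kc/2} removes one, so the exponential stops after its linear term. *)
Lemma serexp_two_terms (t : nat -> Fock -> Fock) r w w' :
  (forall i, linear (t i)) -> (0 < r)%N ->
  (forall i, (0 < i)%N -> t i w = if i == r then w' else 0) ->
  (forall i, (0 < i)%N -> t i w' = 0) ->
  forall n, serexp t n w = (if n == 0%N then w else 0) + (if n == r then w' else 0).
Proof.
move=> lt r0 tw tw' n.
have p1 p : serpow t 1 p w = if p == r then w' else 0.
  case: p => [|p]; first by rewrite /= big_geq // eq_sym (gtn_eqF r0).
  rewrite /= big_nat_recr //= subnn eqxx tw // big1_seq ?add0r // => i /andP[_].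
  rewrite mem_index_iota => /andP[_ lti].
  by rewrite subn_eq0 leqNgt lti (lin0 (lt _)).
have p2 m p : serpow t m.+2 p w = 0.
  elim: m p => [|m IH] p.
    rewrite serpowS big1_seq // => i /andP[_].
    rewrite mem_index_iota => /andP[i0 _]; rewrite p1.
    by case: ifP => _; rewrite ?tw' ?(lin0 (lt _)).
  by rewrite serpowS big1 // => i _; rewrite IH (lin0 (lt _)).
have f0 m : (2 <= m)%N -> (m`!%:R)^-1 *: serpow t m n w = 0.
  by case: m => [|[|m]] // _; rewrite p2 scaler0.
case: n p1 f0 => [|n] p1 f0.
  rewrite /serexp big_ord_recl big_ord0 addr0 /= invr1 scale1r.
  by rewrite [0%N == r]eq_sym (gtn_eqF r0) addr0.
rewrite /serexp -(big_mkord xpredT (fun m => (m`!%:R)^-1 *: serpow t m n.+1 w)).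
rewrite big_nat_recl // big_nat_recl // p1 /= scaler0 !add0r invr1.
rewrite [X in _ + X]big1 ?addr0 => [|m _]; last exact: f0.
by rewrite scale1r.
Qed.

Lemma lat_mode_two_terms k m r w w' : (0 < r)%N ->
  (forall i, (0 < i)%N -> lat_ann k i w = if i == r then w' else 0) ->
  (forall i, (0 < i)%N -> lat_ann k i w' = 0) ->
  lat_mode k m w = lat_coef k (- m - 1) w + lat_coef k (r%:Z - m - 1) w'.
Proof.
move=> r0 tw tw'.
have E := serexp_two_terms (lat_ann_linear k) r0 tw tw'.
have -> : lat_mode k m w = \sum_(q \in [set: nat]%classic)
    lat_coef k (q%:Z - m - 1) (serexp (lat_ann k) q w) by [].
rewrite (@fsum_nat_trunc _ _ r.+1) => [|q lt]; last first.
  rewrite E !gtn_eqF ?(leq_trans _ lt) // addr0.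
  exact: (lin0 (lat_coef_linear _ _)).
under eq_bigr => q _ do rewrite E (linD (lat_coef_linear _ _)).
rewrite big_split /=; congr (_ + _).
  rewrite (bigD1 ord0) //= sub0r big1 ?addr0 // => q.
  by rewrite -val_eqE /= => /negPf->; apply: (lin0 (lat_coef_linear _ _)).
rewrite (bigD1 ord_max) //= eqxx big1 ?addr0 // => q.
by rewrite -val_eqE /= => /negPf->; apply: (lin0 (lat_coef_linear _ _)).
Qed.

(** The factor 2i in [c(i), d(-i)] cancels the denominator 2i of [lat_ann]. *)
Lemma lat_ann_ket k i l A B P N : (0 < i)%N ->
  lat_ann k i (K l A B P N) = (- (k%:~R * (B i.-1)%:R)) *: K l A (B `\ i.-1) P N.
Proof.
case: i => [|i] i0; first discriminate i0.
rewrite /lat_ann (mode_ketE GC i.+1%:Z).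
have -> : mode_ket F GC i.+1%:Z (l, (A, B), (P, N)) =
    (2 * i.+1 * B i)%N%:R *: K l A (B `\ i) P N by [].
have nz : (2 * i.+1)%N%:R != 0 :> F by rewrite pnatr_eq0.
by rewrite scalerA mulNr [(2 * i.+1 * _)%N%:R]natrM mulrA (mulfVK nz).
Qed.

(** With no d to contract, the annihilation part is the identity. This is the two-term formula with
    second vector 0, for which r = 1 is an arbitrary choice. *)
Lemma lat_mode_no_d k m l A P N :
  lat_mode k m (K l A mset0 P N) = lat_coef k (- m - 1) (K l A mset0 P N).
Proof.
rewrite (@lat_mode_two_terms _ _ 1 _ 0) //.
- by rewrite (lin0 (lat_coef_linear _ _)) addr0.
- by move=> i i0; rewrite lat_ann_ket // mset0E mulr0 oppr0 scale0r if_same.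
- by move=> i _; rewrite (lin0 (lat_ann_linear _ _)).
Qed.

(** Contracting d(-n-1) contributes -k x^(-n-1); the creation part must then supply the power (n +
    1) - m - 1 = n - m. *)
Lemma lat_mode_one_d k m l A n P N :
  lat_mode k m (K l A [mset n] P N) =
    lat_coef k (- m - 1) (K l A [mset n] P N)
    - k%:~R *: lat_coef k (n%:Z - m) (K l A mset0 P N).
Proof.
rewrite (@lat_mode_two_terms _ _ n.+1 _ (- k%:~R *: K l A mset0 P N)) //.
- congr (_ + _); rewrite (linZ (lat_coef_linear _ _)) scaleNr.
  by congr (- (_ *: lat_coef _ _ _)); rewrite -addn1 PoszD addrAC addrK.
- case=> // i _; rewrite lat_ann_ket //= eqSS msetnE; case: eqP => [->|_].
    by rewrite mulr1 -{1}[[mset n]%mset]msetD0 msetD1K.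
  by rewrite mulr0 oppr0 scale0r.
- move=> i i0; rewrite (linZ (lat_ann_linear _ _)) lat_ann_ket // mset0E.
  by rewrite mulr0 oppr0 scale0r scaler0.
Qed.

Lemma lat_coef_ket0 k l A B P N : lat_coef k 0 (K l A B P N) = K (k + l) A B P N.
Proof.
rewrite /= /serexp big_ord_recl big_ord0 addr0 /= invr1 scale1r.
by rewrite /lat_shift lin_ext_ket.
Qed.

Lemma lat_coef_ket1 k l A B P N :
  lat_coef k 1 (K l A B P N) = (k%:~R / 2%:R) *: K (k + l) (0%N +` A) B P N.
Proof.
rewrite /= /serexp !big_ord_recl big_ord0 /= invr1 scaler0 add0r scale1r !addr0.
rewrite big_nat1 subnn /= /lat_cre mode_ketE /=.
by rewrite (linZ (lat_shift_linear _)) /lat_shift lin_ext_ket.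
Qed.

Lemma lat_coef_neg k z w : z < 0 -> lat_coef k z w = 0.
Proof. by case: z. Qed.

Lemma elat_prod k n w : Fock_prod (elat F k) n w = lat_mode k n w.
Proof.
by rewrite /Fock_prod lin_ext_ket /state_mode !enum_mset0 !seq_fset0.
Qed.

End LatticeModes.

(** * Products of a with simple basis vectors *)

Section ScreeningVectors.
Variable F : numFieldType.
Local Notation Fock := {malg F[state]}.
Local Notation K k A B P N := (ket F (k, (A%mset, B%mset), (P%fset, N%fset))).

Lemma mode_index_lt0 (m j : nat) : - (m%:Z + j%:Z) - 1 < 0.
Proof. by rewrite -opprD oppr_lt0 ltr_wpDl // addr_ge0. Qed.

Definition vec_b : PiF2 F := elat F 1.
(** The vector Psi^-(-1/2) e^c, through which e^c_0 tau and a_{-1} b are compared. *)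
Definition vec_psiec : PiF2 F := K 2 mset0 mset0 fset0 [fset 0%N].

Lemma vec_aE : vec_a F = K 1 mset0 mset0 fset0 [fset 0%N].
Proof.
rewrite /vec_a /elat mode_ketE /= /cnt_lt seq_fset0 /= expr0 scale1r.
by rewrite fsetU0.
Qed.

Lemma vec_a_prod n (w : Fock) : Fock_prod (vec_a F) n w =
  \sum_(j \in [set: nat]%classic) mode Gminus (- j%:Z - 1) (lat_mode 1 (n + j%:Z) w)
  + \sum_(j \in [set: nat]%classic) lat_mode 1 (n - j%:Z - 1) (mode Gminus j%:Z w).
Proof.
rewrite vec_aE /Fock_prod lin_ext_ket /state_mode !enum_mset0 seq_fset0 seq_fset1 /=.
rewrite /nop /= expr0 scale1r.
have d0 m v : dder 0 (@mode F Gminus) m v = mode Gminus m v.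
  by rewrite /dder /gbinom big_ord0 fact0 divr1 expr0 mulr1 scale1r subr0.
apply: (f_equal2 +%R); apply: eq_fsbigr => j _; first exact: d0.
exact: (f_equal (lat_mode 1 _) (d0 _ _)).
Qed.

Lemma psim_ket_no_plus (m : nat) l A B N : mode Gminus m (K l A B fset0 N) = 0.
Proof. by rewrite mode_ketE. Qed.

(** Neither factor of a finds a partner: Psi^- contracts only with Psi^+, and e^{c/2} only with d.
    This disposes of a, b, e^c, alpha and Psi at once. *)
Lemma vec_a_prod_no_d (m : nat) l A N :
  Fock_prod (vec_a F) m (K l A mset0 fset0 N) = 0.
Proof.
rewrite vec_a_prod !fsum0 ?addr0 // => j.
  by rewrite psim_ket_no_plus (lin0 (field_op_linear (field_op_lat_mode _ _) _)).
rewrite lat_mode_no_d lat_coef_neg ?(lin0 (mode_linear _ _)) //.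
exact: mode_index_lt0.
Qed.

(** The only contraction is that of Psi^+(-n-1/2) with the mode j = n of Psi^-, which leaves the
    mode m - n - 1 of e^{c/2}. *)
Lemma vec_a_prod_plus (m n : nat) l A N :
  Fock_prod (vec_a F) m (K l A mset0 [fset n] N) =
  lat_coef 1 (n%:Z - m%:Z) (K l A mset0 fset0 N).
Proof.
rewrite vec_a_prod fsum0 => [|j]; last first.
  rewrite lat_mode_no_d lat_coef_neg ?(lin0 (mode_linear _ _)) //.
  exact: mode_index_lt0.
rewrite add0r (@fsum_single _ _ n) => [|j jn]; last first.
  rewrite mode_ketE /= in_fset1 (negPf jn).
  by rewrite (lin0 (field_op_linear (field_op_lat_mode _ _) _)).
rewrite mode_ketE /= in_fset1 eqxx /cnt_lt seq_fset1 /= ltnn expr0 scale1r.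
rewrite fsetDv lat_mode_no_d; congr (lat_coef _ _ _).
by rewrite !opprD !opprK addrK addrC.
Qed.

(** Here e^{c/2} contracts with d(-n-1), whence the sign, and Psi^- only creates; the terms with j >
    n vanish because the exponent is negative. *)
Lemma vec_a_prod_one_d (m n : nat) l A N :
  Fock_prod (vec_a F) m (K l A [mset n] fset0 N) =
  - \sum_(j \in [set: nat]%classic) mode Gminus (- j%:Z - 1)
       (lat_coef 1 (n%:Z - m%:Z - j%:Z) (K l A mset0 fset0 N)).
Proof.
rewrite vec_a_prod [X in _ + X]fsum0 => [|j]; last first.
  by rewrite psim_ket_no_plus (lin0 (field_op_linear (field_op_lat_mode _ _) _)).
have tr j : (n.+1 <= j)%N -> mode Gminus (- j%:Z - 1)
       (lat_coef 1 (n%:Z - m%:Z - j%:Z) (K l A mset0 fset0 N)) = 0.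
  move=> lt; rewrite lat_coef_neg ?(lin0 (mode_linear _ _)) //.
  by rewrite -addrA -opprD subr_lt0 -PoszD ltz_nat (leq_trans lt) ?leq_addl.
have E j : mode Gminus (- j%:Z - 1) (lat_mode 1 (m%:Z + j%:Z) (K l A [mset n] fset0 N))
   = - mode Gminus (- j%:Z - 1)
       (lat_coef 1 (n%:Z - m%:Z - j%:Z) (K l A mset0 fset0 N)).
  rewrite lat_mode_one_d lat_coef_neg; last exact: mode_index_lt0.
  by rewrite add0r scale1r (linN (mode_linear _ _)) opprD addrA.
rewrite addr0 [LHS](@fsum_nat_trunc _ _ n.+1); last first.
  by move=> j /tr z; rewrite E z oppr0.
apply: etrans (f_equal -%R (esym (fsum_nat_trunc tr))); rewrite -sumrN.
by apply: eq_bigr => j _; exact: E.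
Qed.

Lemma psim_create (n : nat) l A B N : n \notin N ->
  mode Gminus (- n%:Z - 1) (K l A B fset0 N) =
  (-1) ^+ cnt_lt n N *: K l A B fset0 (n |` N).
Proof. by move=> nN; rewrite -opprD -PoszD addn1 mode_ketE /= (negPf nN). Qed.

Lemma psim_create_mem (n : nat) l A B N : n \in N ->
  mode Gminus (- n%:Z - 1) (K l A B fset0 N) = 0.
Proof. by move=> nN; rewrite -opprD -PoszD addn1 mode_ketE /= nN. Qed.

Lemma vec_a_prod_d1_0 l A N :
  Fock_prod (vec_a F) 0 (K l A [mset 0%N] fset0 N) =
  - mode Gminus (-1) (K (1 + l) A mset0 fset0 N).
Proof.
rewrite (vec_a_prod_one_d 0) (@fsum_single _ _ 0) ?subr0 ?lat_coef_ket0 // => -[|j] // _.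
by rewrite lat_coef_neg ?(lin0 (mode_linear _ _)).
Qed.

Lemma vec_a_prod_d1_S (m : nat) l A N :
  Fock_prod (vec_a F) m.+1 (K l A [mset 0%N] fset0 N) = 0.
Proof.
rewrite vec_a_prod_one_d fsum0 ?oppr0 // => j.
by rewrite lat_coef_neg ?(lin0 (mode_linear _ _)) // sub0r -opprD -PoszD.
Qed.

(** The exponent is 1 - j: j = 0 selects the linear term c(-1)/2 of the creation exponential, j = 1
    its constant term. *)
Lemma vec_a_prod_d2_0 l A N :
  Fock_prod (vec_a F) 0 (K l A [mset 1%N] fset0 N) =
  - (2%:R^-1 *: mode Gminus (-1) (K (1 + l) (0%N +` A) mset0 fset0 N)
     + mode Gminus (-2) (K (1 + l) A mset0 fset0 N)).
Proof.
rewrite (vec_a_prod_one_d 0) (@fsum_nat_trunc _ _ 2) => [|[|[|j]] // _]; last first.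
  by rewrite lat_coef_neg ?(lin0 (mode_linear _ _)).
rewrite big_ord_recl big_ord1.
have -> : 1%:Z - 0%:Z - (@ord0 1)%:Z = 1 by [].
have -> : 1%:Z - 0%:Z - (lift (@ord0 1) ord0)%:Z = 0 by [].
by rewrite lat_coef_ket0 lat_coef_ket1 div1r (linZ (mode_linear _ _)).
Qed.

Lemma vec_a_prod_d2_1 l A N :
  Fock_prod (vec_a F) 1 (K l A [mset 1%N] fset0 N) =
  - mode Gminus (-1) (K (1 + l) A mset0 fset0 N).
Proof.
rewrite (vec_a_prod_one_d 1) (@fsum_single _ _ 0) ?subrr ?subr0 ?lat_coef_ket0 // => -[|j] // _.
by rewrite lat_coef_neg ?(lin0 (mode_linear _ _)).
Qed.

Lemma vec_a_prod_d2_SS (m : nat) l A N :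
  Fock_prod (vec_a F) m.+2 (K l A [mset 1%N] fset0 N) = 0.
Proof.
rewrite vec_a_prod_one_d fsum0 ?oppr0 // => j.
rewrite lat_coef_neg ?(lin0 (mode_linear _ _)) //.
by rewrite -addrA -opprD -PoszD subr_lt0.
Qed.

Lemma vec_a_prod_a (m : nat) : Fock_prod (vec_a F) m (vec_a F) = 0.
Proof. by rewrite [X in Fock_prod _ _ X]vec_aE vec_a_prod_no_d. Qed.

Lemma vec_a_prod_b (m : nat) : Fock_prod (vec_a F) m vec_b = 0.
Proof. exact: vec_a_prod_no_d. Qed.

Lemma vec_a_prod_ec (m : nat) : Fock_prod (vec_a F) m (vec_ec F) = 0.
Proof. exact: vec_a_prod_no_d. Qed.

Lemma vec_a_prod_b_psiec : Fock_prod (vec_a F) (-1) vec_b = vec_psiec.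
Proof.
rewrite vec_a_prod [X in _ + X]fsum0 ?addr0 => [|j]; last first.
  by rewrite psim_ket_no_plus (lin0 (field_op_linear (field_op_lat_mode _ _) _)).
rewrite (@fsum_single _ _ 0) => [|[|j] // _]; last first.
  rewrite lat_mode_no_d lat_coef_neg ?(lin0 (mode_linear _ _)) //.
  by rewrite intS addKr -opprD oppr_lt0 ltr_wpDl.
rewrite addr0 lat_mode_no_d opprK subrr lat_coef_ket0 psim_create // /cnt_lt seq_fset0.
by rewrite expr0 scale1r fsetU0.
Qed.

End ScreeningVectors.

Section LinearCombinations.
Variables (F : fieldType) (U V : lmodType F) (f : U -> V).

Lemma lin_comb4 (x a b c : F) u1 u2 u3 u4 : linear f ->
  f (x *: (a *: u1 + b *: u2 + c *: u3 - u4)) =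
  x *: (a *: f u1 + b *: f u2 + c *: f u3 - f u4).
Proof. by move=> lf; rewrite (linZ lf) (linB lf) !(linD lf) !(linZ lf). Qed.

Lemma lin_comb5 (a b c d : F) u1 u2 u3 u4 u5 : linear f ->
  f (a *: u1 + b *: u2 - c *: u3 + d *: (u4 - u5)) =
  a *: f u1 + b *: f u2 - c *: f u3 + d *: (f u4 - f u5).
Proof.
by move=> lf; rewrite (linD lf) (linB lf) (linD lf) !(linZ lf) (linB lf).
Qed.

End LinearCombinations.

(** * Coefficient arithmetic for the products with omega *)

Section HalfSums.
Variables (F : numFieldType) (V : lmodType F).

Lemma half_sum0 (y : F) (u v : V) :
  2%:R^-1 *: (- u) + y *: 0 - 2%:R^-1 *: (- (2%:R^-1 *: u + v))
  + 2%:R^-1 *: (2%:R^-1 *: u - v) = 0.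
Proof.
have h : 2%:R^-1 *: u + 2%:R^-1 *: u = u.
  by rewrite -scalerDl -[RHS]scale1r [in RHS](splitr 1) !mul1r.
rewrite scaler0 addr0 -[- (2%:R^-1 *: - _)]scalerN opprK -!scalerDr.
have -> : - u + (2%:R^-1 *: u + v) + (2%:R^-1 *: u - v) = 0.
  by rewrite -addrA (addrACA _ v) subrr addr0 h addNr.
by rewrite scaler0.
Qed.

(** This is a_1 omega = a: one half comes from d(-2), the other from omega_fer. *)
Lemma half_sum1 (y : F) (u : V) :
  2%:R^-1 *: 0 + y *: 0 - 2%:R^-1 *: (- u) + 2%:R^-1 *: (u - 0) = u.
Proof.
rewrite !scaler0 !add0r scalerN opprK subr0 -scalerDl.
by rewrite -[RHS]scale1r [in RHS](splitr 1) !mul1r.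
Qed.

Lemma half_sum2 (y : F) :
  2%:R^-1 *: 0 + y *: 0 - 2%:R^-1 *: 0 + 2%:R^-1 *: (0 - 0) = 0 :> V.
Proof. by rewrite subrr !scaler0 !addr0 subrr. Qed.

Lemma half_sum3 (y : F) (u : V) :
  2%:R^-1 *: u + y *: 0 - 2%:R^-1 *: u + 2%:R^-1 *: (0 - 0) = 0.
Proof. by rewrite subrr !scaler0 !addr0 subrr. Qed.

End HalfSums.

(** * Products of a and e^c with the four generators *)

Section Generators.
Variables (C : numClosedFieldType) (cL cLa : C).
Local Notation Fock := {malg C[state]}.
Local Notation K k A B P N := (ket C (k, (A%mset, B%mset), (P%fset, N%fset))).

Let psimE k n A B :
  mode Gminus (Negz n) (K k A B fset0 fset0) = K k A B fset0 [fset n].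
Proof. by rewrite mode_ketE /= /cnt_lt seq_fset0 /= scale1r fsetU0. Qed.

Let psipE k n A B N :
  mode Gplus (Negz n) (K k A B fset0 N) = K k A B [fset n] N.
Proof. by rewrite mode_ketE /= /cnt_lt seq_fset0 /= scale1r fsetU0. Qed.

Let cE k n B P N :
  mode GC (Negz n) (K k mset0 B P N) = K k [mset n] B P N.
Proof. by rewrite mode_ketE /= msetD0. Qed.

Let dE k n A P N :
  mode GD (Negz n) (K k A mset0 P N) = K k A [mset n] P N.
Proof. by rewrite mode_ketE /= msetD0. Qed.

Lemma vec_alphaE : vec_alpha cLa = (- cLa) *: K 0 [mset 0%N] mset0 fset0 fset0.
Proof. by rewrite /vec_alpha [elat _ _]/(K 0 mset0 mset0 fset0 fset0) cE. Qed.

Lemma vec_PsiE :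
  vec_Psi cLa = (- (sqrtC 2%:R * cLa)) *: K 0 mset0 mset0 fset0 [fset 0%N].
Proof. by rewrite /vec_Psi [elat _ _]/(K 0 mset0 mset0 fset0 fset0) psimE. Qed.

Lemma vec_tauE : vec_tau cL =
  sqrtC 2%:R *: (2%:R^-1 *: K 0 [mset 0%N] mset0 [fset 0%N] fset0
                 + 2%:R^-1 *: K 0 mset0 [mset 0%N] fset0 [fset 0%N]
                 + ((cL - 3%:R) / 12%:R) *: K 0 mset0 mset0 fset0 [fset 1%N]
                 - K 0 mset0 mset0 [fset 1%N] fset0).
Proof.
by rewrite /vec_tau [elat _ _]/(K 0 mset0 mset0 fset0 fset0) !psimE !psipE cE dE.
Qed.

Lemma vec_omegaE : vec_omega cL =
  2%:R^-1 *: K 0 [mset 0%N] [mset 0%N] fset0 fset0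
  + ((cL - 3%:R) / 24%:R) *: K 0 [mset 1%N] mset0 fset0 fset0
  - 2%:R^-1 *: K 0 mset0 [mset 1%N] fset0 fset0
  + 2%:R^-1 *: (K 0 mset0 mset0 [fset 1%N] [fset 0%N]
                - K 0 mset0 mset0 [fset 0%N] [fset 1%N]).
Proof.
rewrite /vec_omega /vec_omega_fer [elat _ _]/(K 0 mset0 mset0 fset0 fset0).
rewrite !psimE !psipE !cE !dE !cE.
(* Basis vectors list the Psi^+ first, so moving Psi^-(-3/2) past Psi^+(-1/2) costs a sign. *)
have -> : mode Gminus (-2) (K 0 mset0 mset0 [fset 0%N] fset0) =
    - K 0 mset0 mset0 [fset 0%N] [fset 1%N].
  rewrite (@mode_ketE _ Gminus (Negz 1)) /= cardfs1 /cnt_lt seq_fset0 /=.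
  by rewrite expr1 scaleN1r fsetU0.
by [].
Qed.

Lemma lin_vec_tau (f : Fock -> Fock) r1 r2 r3 r4 : linear f ->
  f (K 0 [mset 0%N] mset0 [fset 0%N] fset0) = r1 ->
  f (K 0 mset0 [mset 0%N] fset0 [fset 0%N]) = r2 ->
  f (K 0 mset0 mset0 fset0 [fset 1%N]) = r3 ->
  f (K 0 mset0 mset0 [fset 1%N] fset0) = r4 ->
  f (vec_tau cL) = sqrtC 2%:R *: (2%:R^-1 *: r1 + 2%:R^-1 *: r2
                                  + ((cL - 3%:R) / 12%:R) *: r3 - r4).
Proof.
move=> lf <- <- <- <-; rewrite vec_tauE.
exact: (lin_comb4 _ _ _ _ _ _ _ _ lf).
Qed.

Lemma lin_vec_omega (f : Fock -> Fock) r1 r2 r3 r4 r5 : linear f ->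
  f (K 0 [mset 0%N] [mset 0%N] fset0 fset0) = r1 ->
  f (K 0 [mset 1%N] mset0 fset0 fset0) = r2 ->
  f (K 0 mset0 [mset 1%N] fset0 fset0) = r3 ->
  f (K 0 mset0 mset0 [fset 1%N] [fset 0%N]) = r4 ->
  f (K 0 mset0 mset0 [fset 0%N] [fset 1%N]) = r5 ->
  f (vec_omega cL) = 2%:R^-1 *: r1 + ((cL - 3%:R) / 24%:R) *: r2
    - 2%:R^-1 *: r3 + 2%:R^-1 *: (r4 - r5).
Proof.
move=> lf <- <- <- <- <-; rewrite vec_omegaE.
exact: (lin_comb5 _ _ _ _ _ _ _ _ _ lf).
Qed.

Lemma vec_a_prod_alpha (m : nat) : Fock_prod (vec_a C) m (vec_alpha cLa) = 0.
Proof.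
by rewrite vec_alphaE (linZ (Fock_prod_linear_r _ _)) vec_a_prod_no_d scaler0.
Qed.

Lemma vec_a_prod_Psi (m : nat) : Fock_prod (vec_a C) m (vec_Psi cLa) = 0.
Proof.
by rewrite vec_PsiE (linZ (Fock_prod_linear_r _ _)) vec_a_prod_no_d scaler0.
Qed.

(** For m = 0, c(-1)Psi^+(-1/2) and Psi^+(-3/2) both yield c(-1) e^{c/2} / 2 and cancel, while the
    d-term gives the square of Psi^-(-1/2), which is zero. For m = 1 only Psi^+(-3/2)
    contributes. *)
Lemma vec_a_prod_tau (m : nat) : Fock_prod (vec_a C) m (vec_tau cL) =
  if m == 1%N then (- sqrtC 2%:R) *: vec_b C else 0.
Proof.
have h2 : Fock_prod (vec_a C) m (K 0 mset0 [mset 0%N] fset0 [fset 0%N]) = 0.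
  case: m => [|m]; last exact: vec_a_prod_d1_S.
  rewrite vec_a_prod_d1_0 (_ : mode _ _ _ = 0) ?oppr0 //.
  by apply: (@psim_create_mem _ 0%N); rewrite inE.
rewrite (lin_vec_tau (Fock_prod_linear_r _ _) (vec_a_prod_plus _ m 0 0 _ _) h2
           (vec_a_prod_no_d _ _ _ _ _) (vec_a_prod_plus _ m 1 0 _ _)).
rewrite !scaler0 !addr0; case: m {h2} => [|[|m]].
- rewrite subr0 lat_coef_ket0 subr0 lat_coef_ket1 div1r msetD0 subrr.
  exact: scaler0.
- rewrite sub0r subrr lat_coef_ket0 lat_coef_neg; last by [].
  rewrite scaler0 sub0r.
  by rewrite scalerN scaleNr.
- rewrite lat_coef_neg; last by [].
  rewrite lat_coef_neg; last by [].
  by rewrite scaler0 subrr scaler0.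
Qed.

Lemma vec_a_prod_omega (m : nat) : Fock_prod (vec_a C) m (vec_omega cL) =
  if m == 1%N then vec_a C else 0.
Proof.
have e2 := vec_a_prod_no_d C m 0 [mset 1%N]%mset fset0.
have e4 := vec_a_prod_plus C m 1 0 mset0 [fset 0%N]%fset.
have e5 := vec_a_prod_plus C m 0 0 mset0 [fset 1%N]%fset.
have ps := psimE _ 0; have ps' := psimE _ 1.
case: m e2 e4 e5 => [|[|m]] e2 e4 e5.
- have e1 := vec_a_prod_d1_0 C 0 [mset 0%N]%mset fset0.
  have e3 := vec_a_prod_d2_0 C 0 mset0 fset0.
  rewrite subr0 lat_coef_ket1 div1r msetD0 in e4.
  rewrite subrr lat_coef_ket0 in e5.
  rewrite msetD0 !ps ps' in e3; rewrite ps in e1.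
  exact: etrans (lin_vec_omega (Fock_prod_linear_r _ _) e1 e2 e3 e4 e5)
    (half_sum0 _ _ _).
- have e1 := vec_a_prod_d1_S C 0 0 [mset 0%N]%mset fset0.
  have e3 := vec_a_prod_d2_1 C 0 mset0 fset0.
  rewrite subrr lat_coef_ket0 in e4.
  rewrite lat_coef_neg in e5; last by [].
  rewrite ps in e3; rewrite [RHS]vec_aE.
  exact: etrans (lin_vec_omega (Fock_prod_linear_r _ _) e1 e2 e3 e4 e5)
    (half_sum1 _ _).
- have e1 := vec_a_prod_d1_S C m.+1 0 [mset 0%N]%mset fset0.
  have e3 := vec_a_prod_d2_SS C m 0 mset0 fset0.
  rewrite lat_coef_neg in e4; last by [].
  rewrite lat_coef_neg in e5; last by [].
  exact: etrans (lin_vec_omega (Fock_prod_linear_r _ _) e1 e2 e3 e4 e5)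
    (half_sum2 _ _).
Qed.

Lemma vec_ec_prod_alpha : Fock_prod (vec_ec C) 0 (vec_alpha cLa) = 0.
Proof.
rewrite vec_alphaE (linZ (Fock_prod_linear_r _ _)) elat_prod lat_mode_no_d.
exact: scaler0.
Qed.

Lemma vec_ec_prod_Psi : Fock_prod (vec_ec C) 0 (vec_Psi cLa) = 0.
Proof.
rewrite vec_PsiE (linZ (Fock_prod_linear_r _ _)) elat_prod lat_mode_no_d.
exact: scaler0.
Qed.

Let ec_no_d l A P N : Fock_prod (vec_ec C) 0 (K l A mset0 P N) = 0.
Proof. by rewrite elat_prod lat_mode_no_d lat_coef_neg. Qed.

Let ec_one_d l A n P N : Fock_prod (vec_ec C) 0 (K l A [mset n] P N) =
  - (2%:R *: lat_coef 2 n (K l A mset0 P N)).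
Proof.
by rewrite elat_prod lat_mode_one_d lat_coef_neg // add0r subr0.
Qed.

(** Only the term with d(-1) contracts with e^c, and the charge 2 cancels its coefficient 1/2. *)
Lemma vec_ec_prod_tau :
  Fock_prod (vec_ec C) 0 (vec_tau cL) = (- sqrtC 2%:R) *: vec_psiec C.
Proof.
rewrite (lin_vec_tau (Fock_prod_linear_r _ _) (ec_no_d _ _ _ _) (ec_one_d _ _ _ _ _)
   (ec_no_d _ _ _ _) (ec_no_d _ _ _ _)).
rewrite lat_coef_ket0 addr0 !scaler0 add0r addr0 subr0 scalerN scalerA mulVf.
  by rewrite scale1r scalerN scaleNr.
by rewrite pnatr_eq0.
Qed.

Lemma vec_ec_prod_omega : Fock_prod (vec_ec C) 0 (vec_omega cL) = 0.
Proof.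
have e1 := ec_one_d 0 [mset 0%N]%mset 0 fset0 fset0.
have e3 := ec_one_d 0 mset0 1 fset0 fset0.
(* The linear term of the creation part of e^c is c(-1), so d(-2) and c(-1)d(-1) produce the same
   vector, with opposite coefficients in omega. *)
have e3' : lat_coef 2 1 (K 0 mset0 mset0 fset0 fset0) =
    lat_coef 2 0 (K 0 [mset 0%N] mset0 fset0 fset0).
  rewrite lat_coef_ket1 lat_coef_ket0 msetD0 divff ?scale1r //.
  by rewrite pnatr_eq0.
rewrite e3' in e3.
exact: etrans (lin_vec_omega (Fock_prod_linear_r _ _) e1 (ec_no_d _ _ _ _) e3
  (ec_no_d _ _ _ _) (ec_no_d _ _ _ _)) (half_sum3 _ _).
Qed.

End Generators.

Section GeneratorGrading.
Variables (C : numClosedFieldType) (cL cLa : C).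

Lemma graded_mode k p g m v : graded k p v ->
  graded k (gen_odd g (+) p) (@mode C g m v).
Proof. by move=> /(shifts_mode (m := m) (g := g)); rewrite add0r. Qed.

Lemma graded_elat k : graded k false (elat C k).
Proof. by apply: supported_ket; rewrite /state_odd cardfs0. Qed.

Lemma graded_alpha : graded 0 false (vec_alpha cLa).
Proof.
by apply: supportedZ; apply: (graded_mode (g := GC) (p := false)); apply: graded_elat.
Qed.

Lemma graded_Psi : graded 0 true (vec_Psi cLa).
Proof.
apply: supportedZ; apply: (graded_mode (g := Gminus) (p := false)).
exact: graded_elat.
Qed.

Lemma graded_tau : graded 0 true (vec_tau cL).
Proof.
have e0 : graded 0 false (elat C 0) by exact: graded_elat.
have gp n := graded_mode (g := Gplus) (m := n) e0.
have gm n := graded_mode (g := Gminus) (m := n) e0.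
apply: supportedZ; apply: supportedD; [apply: supportedD; first apply: supportedD|].
- by apply: supportedZ; apply: (graded_mode (g := GC) (p := true)); apply: gp.
- by apply: supportedZ; apply: (graded_mode (g := GD) (p := true)); apply: gm.
- by apply: supportedZ; apply: gm.
- by apply: supportedN; apply: gp.
Qed.

Lemma graded_omega : graded 0 false (vec_omega cL).
Proof.
have e0 : graded 0 false (elat C 0) by exact: graded_elat.
have gp n := graded_mode (g := Gplus) (m := n) e0.
have gm n := graded_mode (g := Gminus) (m := n) e0.
have gc n := graded_mode (g := GC) (m := n) e0.
have gd n := graded_mode (g := GD) (m := n) e0.
apply: supportedD; first apply: supportedD; first apply: supportedD.
- by apply: supportedZ; apply: (graded_mode (g := GC) (p := false)); apply: gd.
- by apply: supportedZ; apply: gc.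
- by apply: supportedN; apply: supportedZ; apply: gd.
- apply: supportedZ; apply: supportedD.
    by apply: (graded_mode (g := Gplus) (p := true)); apply: gm.
  by apply: (graded_mode (g := Gminus) (p := true)); apply: gp.
Qed.

Lemma graded_vec_a : graded 1 true (vec_a C).
Proof.
apply: (graded_mode (g := Gminus) (p := false)); exact: graded_elat.
Qed.

End GeneratorGrading.

(** * Finite-support sums over N and Z, and binomial coefficients *)

Section FiniteSupport.
Variable V : zmodType.
Local Notation "'fsum' f" := (\sum_(j \in [set: nat]%classic) f j) (at level 10).

Definition fin_supp (f : nat -> V) := exists N, forall j, (N <= j)%N -> f j = 0.

Lemma fsumD f g : fin_supp f -> fin_supp g ->
  \sum_(j \in [set: nat]%classic) (f j + g j) = fsum f + fsum g.
Proof.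
move=> [N f0] [N' g0]; pose K := maxn N N'.
have f0' j : (K <= j)%N -> f j = 0.
  by move=> le; apply: f0; apply: leq_trans le; apply: leq_maxl.
have g0' j : (K <= j)%N -> g j = 0.
  by move=> le; apply: g0; apply: leq_trans le; apply: leq_maxr.
rewrite (fsum_nat_trunc f0') (fsum_nat_trunc g0') -big_split /=.
by apply: fsum_nat_trunc => j le; rewrite f0' // g0' // addr0.
Qed.

Lemma fsumN f : fin_supp f ->
  \sum_(j \in [set: nat]%classic) - f j = - fsum f.
Proof.
move=> [N f0]; rewrite (fsum_nat_trunc f0) -sumrN.
by apply: fsum_nat_trunc => j le; rewrite f0 // oppr0.
Qed.

Lemma fsum_recl f : fin_supp f ->
  fsum f = f 0%N + \sum_(j \in [set: nat]%classic) f j.+1.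
Proof.
move=> [N f0]; rewrite (@fsum_nat_trunc _ f N.+1); last first.
  by move=> j lt; apply: f0; apply: ltnW.
rewrite (@fsum_nat_trunc _ (fun j => f j.+1) N) ?big_ord_recl //.
by move=> j le; apply: f0; apply: leqW.
Qed.

Lemma fsum_int (g : int -> V) :
  fin_supp (fun i => g (Posz i)) -> fin_supp (fun i => g (Negz i)) ->
  \sum_(j \in [set: int]%classic) g j =
  \sum_(i \in [set: nat]%classic) g (Posz i) + \sum_(i \in [set: nat]%classic) g (Negz i).
Proof.
move=> [N p0] [N' n0]; rewrite (fsum_nat_trunc p0) (fsum_nat_trunc n0).
rewrite (@fsbigE _ _ _ _ _ (map Posz (iota 0 N) ++ map Negz (iota 0 N'))) //.
- rewrite big_mkcond /= big_cat /= !big_map -!(big_mkord xpredT (fun i => g (_ i))).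
  by rewrite /index_iota !subn0; congr (_ + _); apply: eq_bigr => i _; rewrite mem_set.
- rewrite cat_uniq !map_inj_uniq ?iota_uniq ?andbT /=; try by move=> ? ? [].
  by apply/hasPn => _ /mapP[i _ ->]; apply/mapP => -[].
- move=> [i|i] _ /=; rewrite mem_cat negb_or => /andP[/mapP iN /mapP iN'].
    by apply: p0; rewrite leqNgt; apply/negP => lt; apply: iN; exists i; rewrite ?mem_iota.
  by apply: n0; rewrite leqNgt; apply/negP => lt; apply: iN'; exists i; rewrite ?mem_iota.
Qed.

End FiniteSupport.

(** The reflection j -> c - j permutes Z, so the sum over Z equals its negative, and 2 is
    invertible. Neither half-line is preserved, hence the passage through Z. *)
Lemma fsum_int_antisym (F : numFieldType) (V : lmodType F) (g : int -> V) (c : int) :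
  fin_supp (fun i => g (Posz i)) -> fin_supp (fun i => g (Negz i)) ->
  (forall j, g (c - j) = - g j) ->
  \sum_(i \in [set: nat]%classic) g (Posz i)
    + \sum_(i \in [set: nat]%classic) g (Negz i) = 0.
Proof.
move=> gp gn anti; have E := fsum_int gp gn; rewrite -E.
have : \sum_(j \in [set: int]%classic) g j = - \sum_(j \in [set: int]%classic) g j.
  rewrite {1}(@reindex_fsbigT _ _ _ _ _ (fun j => c - j)); last first.
    by exists (fun j => c - j) => j; rewrite opprB addrC subrK.
  have ng : fin_supp (fun i => - g (Posz i)) /\ fin_supp (fun i => - g (Negz i)).
    have [[N p0] [N' n0]] := (gp, gn).
    by split; [exists N | exists N'] => j le; rewrite ?p0 ?n0 ?oppr0.
  under eq_fsbigr => j _ do rewrite anti.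
  by rewrite (fsum_int ng.1 ng.2) E opprD !fsumN.
move/eqP; rewrite -addr_eq0 -mulr2n -scaler_nat scaler_eq0 pnatr_eq0 /=.
by move/eqP.
Qed.

Lemma gbinomr0 (F : fieldType) (x : F) : gbinom x 0 = 1.
Proof. by rewrite /gbinom big_ord0 divr1. Qed.

Lemma gbinomr1 (F : fieldType) (x : F) : gbinom x 1 = x.
Proof. by rewrite /gbinom big_ord1 subr0 divr1. Qed.

Lemma gbinom0S (F : fieldType) j : gbinom (0 : F) j.+1 = 0.
Proof. by rewrite /gbinom big_ord_recl subr0 !mul0r. Qed.

Lemma gbinomN1 (F : numFieldType) j : gbinom (-1 : F) j = (-1) ^+ j.
Proof.
apply: (canLR (mulfK _)); first by rewrite pnatr_eq0 -lt0n fact_gt0.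
elim: j => [|j IH]; first by rewrite big_ord0 fact0 mulr1.
by rewrite big_ord_recr /= IH factS natrM exprS -[j.+1]addn1 natrD; ring.
Qed.

(** * Modules and the screening operator *)

Section CosetModules.
Variables (F : numFieldType) (V : vsa_data F) (grd : int -> bool -> V -> Prop).

(* Common form of modules ([ra = false]) and of modules twisted by e^{pi i d(0)}
   ([ra = true]): a vector of charge k has its modes in (ra && odd k)/2 + Z. *)
Record coset_module (ra : bool) (M : lmodType F) (Y : V -> rat -> M -> M) : Prop :=
  CosetModule {
  cm_linear_l : forall q w, linear (fun v => Y v q w);
  cm_linear_r : forall v q, linear (Y v q);
  cm_field : forall v w, exists N : rat, forall q, N <= q -> Y v q w = 0;
  cm_vac : forall q w, Y (vsa_vac V) q w = if q == -1 then w else 0;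
  cm_coset : forall k p v, grd k p v ->
    forall q w, ~ in_coset (ra && odd `|k|%N) q -> Y v q w = 0;
  cm_borcherds : forall k l pu pv (u v : V), grd k pu u -> grd l pv v ->
    forall (m q : rat) (n : int) (w : M),
    in_coset (ra && odd `|k|%N) m -> in_coset (ra && odd `|l|%N) q ->
    \sum_(j \in [set: nat]%classic)
       gbinom (ratr m : F) j *: Y (vsa_prod u (n + j%:Z) v) (m + q - j%:R) w
    = \sum_(j \in [set: nat]%classic)
       ((-1) ^+ j * gbinom (n%:~R : F) j) *:
         (Y u (m + n%:~R - j%:R) (Y v (q + j%:R) w)
          - ((-1) ^+ (pu && pv) * (-1) ^ n) *:
              Y v (n%:~R + q - j%:R) (Y u (m + j%:R) w)) }.


Section CosetModuleTheory.
Variables (ra : bool) (M : lmodType F) (Y : V -> rat -> M -> M).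
Hypothesis mY : coset_module ra Y.

Local Notation coset k q := (in_coset (ra && odd `|k|%N) q).

Lemma cmD v q w w' : Y v q (w + w') = Y v q w + Y v q w'.
Proof. exact: (linD (cm_linear_r mY v q)). Qed.

Lemma cm0 v q : Y v q 0 = 0.
Proof. exact: (lin0 (cm_linear_r mY v q)). Qed.

Lemma cmZ v q a w : Y v q (a *: w) = a *: Y v q w.
Proof. exact: (linZ (cm_linear_r mY v q)). Qed.

Lemma cm0l q w : Y 0 q w = 0.
Proof. exact: (lin0 (cm_linear_l mY q w)). Qed.

Lemma cmZl a v q w : Y (a *: v) q w = a *: Y v q w.
Proof. exact: (linZ (cm_linear_l mY q w)). Qed.

Lemma cm_fin_supp v (x : rat) w : exists N, forall j, (N <= j)%N -> Y v (x + j%:R) w = 0.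
Proof.
have [N HN] := cm_field mY v w.
have [n lt] : exists n : nat, N - x < n%:R.
  exists (Num.bound `|N - x|).
  exact: le_lt_trans (ler_norm _) (archi_boundP (normr_ge0 _)).
exists n => j le; apply: HN; rewrite addrC -lerBlDr; apply/ltW.
by apply: lt_le_trans lt _; rewrite ler_nat.
Qed.

(** The Borcherds identity at n = 0, where the binomials on the right vanish for j > 0. *)
Lemma cm_commutator k l pu pv u v : grd k pu u -> grd l pv v ->
  forall m q w, coset k m -> coset l q ->
  Y u m (Y v q w) = (-1) ^+ (pu && pv) *: Y v q (Y u m w) +
    \sum_(j \in [set: nat]%classic) gbinom (ratr m : F) j *:
        Y (vsa_prod u j%:Z v) (m + q - j%:R) w.
Proof.
move=> gu gv m q w cm cq; have := cm_borcherds mY gu gv 0 w cm cq.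
rewrite [X in _ = X](@fsum_single _ _ 0) => [|[|j] // _]; last first.
  by rewrite gbinom0S mulr0 scale0r.
rewrite gbinomr0 expr0 mulr1 scale1r expr0z mulr1 mulr0z !addr0 ?subr0 add0r.
under eq_fsbigr => j _ do rewrite add0r.
by move=> ->; rewrite addrC subrK.
Qed.

Lemma cm_supercommute k l pu pv u v : grd k pu u -> grd l pv v ->
  (forall j : nat, vsa_prod u j v = 0) ->
  forall m q w, coset k m -> coset l q ->
  Y u m (Y v q w) = (-1) ^+ (pu && pv) *: Y v q (Y u m w).
Proof.
move=> gu gv uv m q w cm cq; rewrite (cm_commutator gu gv _ cm cq) fsum0 ?addr0 // => j.
by rewrite uv cm0l scaler0.
Qed.

Lemma cm_commutator_1 k l pu pv u v z : grd k pu u -> grd l pv v ->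
  (forall j : nat, vsa_prod u j v = if j == 1%N then z else 0) ->
  forall m q w, coset k m -> coset l q ->
  Y u m (Y v q w) = (-1) ^+ (pu && pv) *: Y v q (Y u m w)
    + ratr m *: Y z (m + q - 1) w.
Proof.
move=> gu gv uv m q w cm cq; rewrite (cm_commutator gu gv _ cm cq).
rewrite (@fsum_single _ _ 1) ?gbinomr1 ?uv // => j /negPf j1.
by rewrite uv j1 cm0l scaler0.
Qed.

Lemma cm_commutator_m0 k l pu pv u v : grd k pu u -> grd l pv v ->
  forall q w, coset k 0 -> coset l q ->
  Y u 0 (Y v q w) = (-1) ^+ (pu && pv) *: Y v q (Y u 0 w)
    + Y (vsa_prod u 0 v) q w.
Proof.
move=> gu gv q w cm cq; rewrite (cm_commutator gu gv _ cm cq).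
rewrite (@fsum_single _ _ 0) => [|[|j] // _]; last by rewrite rmorph0 gbinom0S scale0r.
by rewrite gbinomr0 scale1r add0r subr0.
Qed.

Lemma cm_product k l pu pv u v : grd k pu u -> grd l pv v ->
  forall n q w, coset k 0 -> coset l q ->
  Y (vsa_prod u n v) q w = \sum_(j \in [set: nat]%classic)
    ((-1) ^+ j * gbinom (n%:~R : F) j) *:
      (Y u (n%:~R - j%:R) (Y v (q + j%:R) w)
       - ((-1) ^+ (pu && pv) * (-1) ^ n) *: Y v (n%:~R + q - j%:R) (Y u j%:R w)).
Proof.
move=> gu gv n q w cm cq; have := cm_borcherds mY gu gv n w cm cq.
rewrite (@fsum_single _ _ 0) => [|[|j] // _]; last by rewrite rmorph0 gbinom0S scale0r.
rewrite gbinomr0 scale1r addr0 add0r subr0 => ->.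
by apply: eq_fsbigr => j _; rewrite !add0r.
Qed.

(** The index m is left free because 0 need not be a mode index of u in the twisted case. Normal
    ordering may be split at any m: the corrections are the modes of u_j v with j >= 0, all zero by
    hypothesis. *)
Lemma cm_normal_product k l pu pv u v : grd k pu u -> grd l pv v ->
  pu && pv = false -> (forall j : nat, vsa_prod u j v = 0) ->
  forall m q w, coset k m -> coset l q ->
  Y (vsa_prod u (-1) v) (m + q) w = \sum_(j \in [set: nat]%classic)
    (Y u (m - 1 - j%:R) (Y v (q + j%:R) w) + Y v (q - 1 - j%:R) (Y u (m + j%:R) w)).
Proof.
move=> gu gv e uv m q w cm cq; have := cm_borcherds mY gu gv (-1) w cm cq.
rewrite (@fsum_single _ _ 0) => [|[|j] // _]; last first.
  by rewrite (_ : -1 + j.+1%:Z = j) ?uv ?cm0l ?scaler0 // intS addKr.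
rewrite gbinomr0 scale1r addr0 subr0 => ->; apply: eq_fsbigr => j _.
rewrite rmorphN1 gbinomN1 -expr2 sqrr_sign scale1r e mul1r.
have -> : (-1 : F) ^ (-1) = -1 by rewrite exprN1 invrN1.
by rewrite [-1 + q]addrC scaleN1r opprK.
Qed.

End CosetModuleTheory.

End CosetModules.

Lemma in_cosetP (r : bool) (q : rat) :
  in_coset r q <-> exists z : int, q = z%:~R + (r : nat)%:R / 2%:R.
Proof.
split=> [/intrP[z E]|[z ->]]; first by exists z; rewrite -E subrK.
by rewrite /in_coset addrK; apply: intr_int.
Qed.

Lemma intr_Negz i : (Negz i)%:~R = - i%:R - 1 :> rat.
Proof. by rewrite NegzE intS rmorphN rmorphD /= -pmulrn opprD addrC. Qed.

(** * The operators S and G, and the vectors whose modes commute with G on the kernel *)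

Section ScreeningOperators.
Variables (F : numFieldType) (V : vsa_data F) (grd : int -> bool -> V -> Prop).
Variables (ra : bool) (M : lmodType F) (Y : V -> rat -> M -> M).
Hypothesis mY : coset_module grd ra Y.
Variables (a b ec : V).
Hypotheses (grd_a : grd 1 true a) (grd_b : grd 1 false b) (grd_ec : grd 2 false ec).
Hypotheses (aa0 : forall j : nat, vsa_prod a j a = 0)
  (ab0 : forall j : nat, vsa_prod a j b = 0) (aec0 : vsa_prod a 0 ec = 0).

Local Notation h := ((ra : nat)%:R / 2%:R : rat).
Local Notation A := (Y a).

(* The positive elements of ra/2 + Z in increasing order. *)
Definition srad (i : nat) : rat := i%:R + 1 - h.

Definition screenS (w : M) : M :=
  \sum_(i \in [set: nat]%classic)
     (ratr (srad i))^-1 *: A (- srad i) (A (srad i) w).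

Definition screenG (w : M) : M := Y ec 0 w - screenS w.

Let Y0 := cm0 mY.

Lemma ratr_srad_neq0 i : ratr (srad i) != 0 :> F.
Proof.
rewrite fmorph_eq0 /srad gt_eqF //.
have i0 : 0 <= i%:R :> rat by [].
by case: ra => /=; lra.
Qed.

Lemma coset_a (z : int) : in_coset (ra && odd `|1%:Z|%N) (z%:~R + h).
Proof. by rewrite andbT; apply/in_cosetP; exists z. Qed.

Lemma coset_even k (z : int) : ~~ odd `|k|%N -> in_coset (ra && odd `|k|%N) z%:~R.
Proof. by move=> /negPf->; rewrite andbF; apply/in_cosetP; exists z; rewrite mul0r addr0. Qed.

Lemma coset_srad i : in_coset (ra && odd `|1%:Z|%N) (srad i).
Proof.
have -> : srad i = (i%:Z + 1 - (ra : nat)%:Z)%:~R + h.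
  by rewrite rmorphB rmorphD /= -!pmulrn /srad; case: ra => /=; lra.
exact: coset_a.
Qed.

Lemma coset_sradN i : in_coset (ra && odd `|1%:Z|%N) (- srad i).
Proof.
have -> : - srad i = (- i%:Z - 1)%:~R + h.
  by rewrite rmorphB rmorphN /= -!pmulrn /srad; case: ra => /=; lra.
exact: coset_a.
Qed.

Lemma srad_fin_supp v (x : rat) w : fin_supp (fun i => Y v (srad i + x) w).
Proof.
have [N HN] := cm_fin_supp mY v (1 - h + x) w.
by exists N => j /HN; rewrite [_ + j%:R]addrC !addrA.
Qed.

Lemma screenS_linear : linear screenS.
Proof.
apply: lin_fsum => [i x u v|w].
  by rewrite !(cm_linear_r mY) scalerDr !scalerA [x * _]mulrC.
have [N HN] := srad_fin_supp a 0 w; exists N => j /HN.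
by rewrite addr0 => ->; rewrite Y0 scaler0.
Qed.

Lemma screenG_linear : linear screenG.
Proof.
move=> x u v; rewrite /screenG screenS_linear (cm_linear_r mY).
by rewrite scalerBr opprD addrACA.
Qed.

(* The relations [a_r, t]_e = s r b_r and [a_{-r}, t]_e = - s r b_{-r}, with
   bp = b_r and bn = b_{-r}, make the factor 1/r in S cancel. *)
Lemma screenS_commute (t : M -> M) (e s : F) (bp bn : nat -> M -> M) w :
  linear t -> e * e = 1 -> (forall i, bn i 0 = 0) -> fin_supp (fun i => bp i w) ->
  (forall i w, A (srad i) (t w) =
     e *: t (A (srad i) w) + (s * ratr (srad i)) *: bp i w) ->
  (forall i w, A (- srad i) (t w) =
     e *: t (A (- srad i) w) - (s * ratr (srad i)) *: bn i w) ->
  screenS (t w) = t (screenS w) + s *: \sum_(i \in [set: nat]%classic)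
     (A (- srad i) (bp i w) - e *: bn i (A (srad i) w)).
Proof.
move=> lt e1 bn0 [N bp0] Ap An.
have [N' HN'] := srad_fin_supp a 0 w.
have a0 i : (N' <= i)%N -> A (srad i) w = 0 by move/HN'; rewrite addr0.
pose K := maxn N N'.
have bp0' i : (K <= i)%N -> bp i w = 0.
  by move=> le; apply: bp0; apply: leq_trans le; apply: leq_maxl.
have a0' i : (K <= i)%N -> A (srad i) w = 0.
  by move=> le; apply: a0; apply: leq_trans le; apply: leq_maxr.
rewrite /screenS (@fsum_nat_trunc _ _ K) => [|i le]; last first.
  by rewrite Ap a0' // bp0' // (lin0 lt) !scaler0 addr0 Y0 scaler0.
rewrite (@fsum_nat_trunc _ _ K) => [|i le]; last by rewrite a0' // Y0 scaler0.
rewrite (@fsum_nat_trunc _ _ K) => [|i le]; last first.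
  by rewrite a0' // bp0' // bn0 Y0 scaler0 subrr.
rewrite (lin_sum lt) scaler_sumr -big_split /=; apply: eq_bigr => i _.
set x := ratr (srad i); have x0 : x != 0 by apply: ratr_srad_neq0.
rewrite Ap (cmD mY) !(cmZ mY) An scalerBr !scalerA e1 scale1r (linZ lt).
rewrite scalerDr scalerBr !scalerA scalerBr !scalerA -addrA; congr (_ + _).
have -> : x^-1 * (e * (s * x)) = s * e by field.
have -> : x^-1 * (s * x) = s by field.
by rewrite addrC.
Qed.

Lemma screenS_supercommute (t : M -> M) (e : F) :
  linear t -> e * e = 1 -> 
  (forall q w, in_coset (ra && odd `|1%:Z|%N) q -> A q (t w) = e *: t (A q w)) ->
  forall w, screenS (t w) = t (screenS w).
Proof.
move=> lt e1 At w.
rewrite (@screenS_commute t e 0 (fun _ _ => 0) (fun _ _ => 0) w) //.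
- by rewrite scale0r addr0.
- by exists 0%N.
- by move=> i w'; rewrite At ?scaler0 ?addr0 //; apply: coset_srad.
- by move=> i w'; rewrite At ?scaler0 ?subr0 //; apply: coset_sradN.
Qed.

Lemma mode_a_anticommute q r w :
  in_coset (ra && odd `|1%:Z|%N) q -> in_coset (ra && odd `|1%:Z|%N) r ->
  A q (A r w) = - A r (A q w).
Proof.
by move=> cq cr; rewrite (cm_supercommute mY grd_a grd_a aa0 _ cq cr) scaleN1r.
Qed.

(** Twisted modes of a lie in 1/2 + Z. Every vector is therefore in the kernel, and statements about
    the kernel cover the whole twisted module. *)
Lemma mode_a0 w : ra -> A 0 w = 0.
Proof.
move=> ra1; apply: (cm_coset mY grd_a); rewrite ra1 => /in_cosetP[z] /= E.
have : (2 * z + 1)%:~R = 0 :> rat by rewrite rmorphD rmorphM /=; lra.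
by move/eqP; rewrite intr_eq0 => /eqP; lia.
Qed.


Lemma kernel_sum_tau (z : int) w : A 0 w = 0 ->
  Y (vsa_prod a (-1) b) z%:~R w = \sum_(i \in [set: nat]%classic)
    (A (- srad i) (Y b (srad i + (z%:~R - 1)) w)
     + Y b (- srad i + (z%:~R - 1)) (A (srad i) w)).
Proof.
move=> w0.
have ch : in_coset (ra && odd `|1%:Z|%N) h by rewrite -[h]add0r; apply: (coset_a 0).
have cz : in_coset (ra && odd `|1%:Z|%N) (z%:~R - h).
  have -> : z%:~R - h = (z - (ra : nat)%:Z)%:~R + h.
    by rewrite rmorphB /= -!pmulrn; case: ra => /=; lra.
  exact: coset_a.
(* Splitting at m = h, the least non-negative index of a, makes the left modes of a exactly those of
   index -r. *)
have := cm_normal_product mY grd_a grd_b erefl ab0 w ch cz.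
rewrite addrC subrK => ->.
have fb : fin_supp (fun i => A (- srad i) (Y b (srad i + (z%:~R - 1)) w)).
  by have [N HN] := srad_fin_supp b (z%:~R - 1) w; exists N => i /HN ->.
have fa : fin_supp (fun i => Y b (- srad i + (z%:~R - 1)) (A (srad i) w)).
  have [N HN] := srad_fin_supp a 0 w; exists N => i /HN.
  by rewrite addr0 => ->.
have fa' : fin_supp (fun i => Y b (z%:~R - h - 1 - i%:R) (A (h + i%:R) w)).
  by have [N HN] := cm_fin_supp mY a h w; exists N => i /HN ->.
have E i : A (h - 1 - i%:R) (Y b (z%:~R - h + i%:R) w) =
    A (- srad i) (Y b (srad i + (z%:~R - 1)) w).
  by congr (A _ (Y b _ w)); rewrite /srad; ring.
under eq_fsbigr => i _ do rewrite E.
rewrite !fsumD //; congr (_ + _).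
(* Twisted: the indices h + i are already the r. Untwisted: i = 0 gives the extra term with a_0 w =
   0, and the others shift by one. *)
have [ra1|ra0] : ra \/ ra = false by case: (ra); [left | right].
  by apply: eq_fsbigr => i _; congr (Y b _ (A _ w)); rewrite /srad ra1 /=; lra.
apply: etrans (fsum_recl fa') _.
rewrite ra0 mul0r add0r w0 Y0 add0r; apply: eq_fsbigr => i _.
by congr (Y b _ (A _ w)); rewrite /srad ra0 -addn1 natrD /=; lra.
Qed.

Lemma kernel_sum_omega (p : int) w : A 0 w = 0 ->
  \sum_(i \in [set: nat]%classic)
    (A (- srad i) (A (srad i + p%:~R) w) - A (- srad i + p%:~R) (A (srad i) w)) = 0.
Proof.
move=> w0; pose f (x : rat) := A (- x) (A (x + p%:~R) w).
pose g (j : int) := f (j%:~R + 1 - h).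
have cx (j : int) : in_coset (ra && odd `|1%:Z|%N) (j%:~R + 1 - h).
  have -> : j%:~R + 1 - h = (j + 1 - (ra : nat)%:Z)%:~R + h.
    by rewrite rmorphB rmorphD /= -!pmulrn; case: ra => /=; lra.
  exact: coset_a.
have cNx (j : int) : in_coset (ra && odd `|1%:Z|%N) (- (j%:~R + 1 - h)).
  have -> : - (j%:~R + 1 - h) = (- j - 1)%:~R + h.
    by rewrite rmorphB rmorphN /=; lra.
  exact: coset_a.
have cD (x : rat) (z : int) : in_coset (ra && odd `|1%:Z|%N) x ->
    in_coset (ra && odd `|1%:Z|%N) (x + z%:~R).
  rewrite andbT => /in_cosetP[y ->]; apply/in_cosetP; exists (y + z).
  by rewrite rmorphD /=; ring.
have fN x : in_coset (ra && odd `|1%:Z|%N) x ->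
    in_coset (ra && odd `|1%:Z|%N) (- x) -> f (- p%:~R - x) = - f x.
  move=> c c'; rewrite /f opprB opprK addrAC addNr add0r mode_a_anticommute //; last exact: cD.
(* The reflection x -> -p - x, written in j with x = j + 1 - h, has constant -p - 2 + 2h, and 2h is
   [ra]. *)
have anti j : g (- p - 2 + (ra : nat)%:Z - j) = - g j.
  rewrite /g -(fN _ (cx j) (cNx j)); congr f.
  by rewrite !(rmorphB, rmorphD, rmorphN) /= -!pmulrn; case: ra => /=; lra.
have gp : fin_supp (fun i => g (Posz i)).
  have [N HN] := srad_fin_supp a p%:~R w; exists N => i /HN E.
  by rewrite /g /f -pmulrn E Y0.
have gn : fin_supp (fun i => g (Negz i)).
  have [N HN] := cm_fin_supp mY a h w; exists N => i /HN E.
  (* For negative j the mode of high index is the left one, so the two are exchanged before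
     truncating. *)
  rewrite /g /f mode_a_anticommute //; last exact: cD.
  have -> : - ((Negz i)%:~R + 1 - h) = h + i%:R.
    by rewrite intr_Negz; lra.
  by rewrite E Y0 oppr0.
have E i : A (- srad i) (A (srad i + p%:~R) w) - A (- srad i + p%:~R) (A (srad i) w)
    = g (Posz i) + f (- srad i).
  congr (_ + _).
  rewrite mode_a_anticommute ?opprK /f ?opprK //; first exact/cD/coset_sradN.
  exact: coset_srad.
under eq_fsbigr => i _ do rewrite E.
rewrite -[RHS](fsum_int_antisym gp gn anti).
(* Twisted: the indices r and -r exhaust 1/2 + Z. Untwisted: x = 0, that is j = -1, is missing from
   the sum; its term is -a_p a_0 w = 0. *)
have [ra1|ra0] : ra \/ ra = false by case: (ra); [left | right].
  have E' i : f (- srad i) = g (Negz i).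
    by rewrite /g; congr f; rewrite intr_Negz /srad ra1 /=; lra.
  under eq_fsbigr => i _ do rewrite E'.
  by rewrite fsumD.
have E' i : f (- srad i) = g (Negz i.+1).
  by rewrite /g; congr f; rewrite intr_Negz -addn1 natrD /srad ra0 /=; lra.
have gn' : fin_supp (fun i => g (Negz i.+1)).
  by have [N HN] := gn; exists N => i le; apply: HN; apply: leqW.
under eq_fsbigr => i _ do rewrite E'.
rewrite fsumD //; congr (_ + _); apply/esym.
apply: etrans (fsum_recl gn) _.
rewrite (_ : g (Negz 0) = 0) ?add0r //.
have e0 : - (- 1 + 1 - h) = 0 :> rat by rewrite ra0 /=; lra.
rewrite /g /f mode_a_anticommute //; last by apply: cD; apply: (cx (Negz 0)).
  by rewrite [(Negz 0)%:~R]/(- 1) e0 w0 Y0 oppr0.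
Qed.


Lemma even_coset_nonint k p v q w : grd k p v -> ~~ odd `|k|%N ->
  ~ in_coset false q -> Y v q w = 0.
Proof.
by move=> gv /negPf ek nq; apply: (cm_coset mY gv); rewrite ek andbF.
Qed.

Lemma in_coset_false q : reflect (exists z : int, q = z%:~R) `[< in_coset false q >].
Proof.
apply: (iffP (asboolP _)) => [/in_cosetP[z ->]|[z ->]].
  by exists z; rewrite mul0r addr0.
by apply/in_cosetP; exists z; rewrite mul0r addr0.
Qed.

Lemma kernel_a0 pv v : grd 0 pv v -> vsa_prod a 0 v = 0 ->
  forall (z : int) w, A 0 w = 0 -> A 0 (Y v z%:~R w) = 0.
Proof.
move=> gv av z w w0.
have [ra1|ra0] : ra \/ ra = false by case: (ra); [left | right].
  exact: mode_a0.
have c0 : in_coset (ra && odd `|1%:Z|%N) 0.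
  by rewrite ra0; apply/in_cosetP; exists 0; rewrite mul0r addr0.
rewrite (cm_commutator_m0 mY grd_a gv w c0 (@coset_even 0 z isT)).
by rewrite w0 Y0 scaler0 av (cm0l mY) addr0.
Qed.

(** Stability of the kernel is included because, in a product of two modes, the outer one is applied
    to the image of the inner one, which must still lie in the kernel. *)
Definition commutes_screen (v : V) := forall q w, A 0 w = 0 ->
  A 0 (Y v q w) = 0 /\ screenG (Y v q w) = Y v q (screenG w).

Let screenG0 : screenG 0 = 0.
Proof. exact: (lin0 screenG_linear). Qed.

(** Since [e^c_0, v_z] = (e^c_0 v)_z, it remains to find the same commutator for S; a vector of
    charge 0 has integer modes only. *)
Lemma commutes_screen_int p v : grd 0 p v -> vsa_prod a 0 v = 0 ->
  (forall (z : int) w, A 0 w = 0 ->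
     screenS (Y v z%:~R w) = Y v z%:~R (screenS w) + Y (vsa_prod ec 0 v) z%:~R w) ->
  commutes_screen v.
Proof.
move=> gv av Sv q w w0; case: (in_coset_false q) => [[z ->]|nz]; last first.
  have v0 w' : Y v q w' = 0.
    by apply: (even_coset_nonint _ gv) => // /asboolP/in_coset_false.
  by rewrite !v0 Y0 screenG0.
split; first exact: kernel_a0 gv av _ _ w0.
have c0 : in_coset (ra && odd `|2%:Z|%N) 0 by apply: (coset_even 0).
rewrite /screenG (cm_commutator_m0 mY grd_ec gv w c0 (@coset_even 0 z isT)).
rewrite scale1r Sv // (linB (cm_linear_r mY v _)) opprD addrACA subrr addr0.
by [].
Qed.

Lemma commutes_screen_trivial p v : grd 0 p v ->
  (forall j : nat, vsa_prod a j v = 0) -> vsa_prod ec 0 v = 0 -> commutes_screen v.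
Proof.
move=> gv av ev; apply: (commutes_screen_int gv (av 0%N)) => z w w0.
rewrite ev (cm0l mY) addr0.
apply: (@screenS_supercommute _ ((-1) ^+ (true && p))).
- exact: (cm_linear_r mY).
- by rewrite -expr2 sqrr_sign.
- move=> q w' cq; exact: (cm_supercommute mY grd_a gv av _ cq (@coset_even 0 z isT)).
Qed.

Lemma commutes_screen_tau t (x : F) : grd 0 true t ->
  (forall j : nat, vsa_prod a j t = if j == 1%N then x *: b else 0) ->
  vsa_prod ec 0 t = x *: vsa_prod a (-1) b -> commutes_screen t.
Proof.
move=> gt at_ et; apply: (commutes_screen_int gt (at_ 0%N)) => z w w0.
rewrite et (cmZl mY) (kernel_sum_tau _ w0).
have cm q w' : in_coset (ra && odd `|1%:Z|%N) q ->
    A q (Y t z%:~R w') = - 1 *: Y t z%:~R (A q w')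
      + (x * ratr q) *: Y b (q + (z%:~R - 1)) w'.
  move=> cq; rewrite (cm_commutator_1 mY grd_a gt at_ _ cq (@coset_even 0 z isT)).
  by rewrite (cmZl mY) scalerA [x * _]mulrC addrA.
rewrite (@screenS_commute _ (-1) x (fun i => Y b (srad i + (z%:~R - 1)))
  (fun i => Y b (- srad i + (z%:~R - 1)))).
- congr (_ + _ *: _); apply: eq_fsbigr => i _.
  by rewrite scaleN1r opprK.
- exact: (cm_linear_r mY).
- by rewrite mulrNN mulr1.
- by move=> i; apply: Y0.
- exact: srad_fin_supp.
- by move=> i w'; apply: cm; apply: coset_srad.
- move=> i w'; rewrite cm; last exact: coset_sradN.
  by rewrite rmorphN mulrN !scaleNr.
Qed.

Lemma commutes_screen_omega o : grd 0 false o ->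
  (forall j : nat, vsa_prod a j o = if j == 1%N then a else 0) ->
  vsa_prod ec 0 o = 0 -> commutes_screen o.
Proof.
move=> go ao eo; apply: (commutes_screen_int go (ao 0%N)) => z w w0.
rewrite eo (cm0l mY) addr0.
have cm q w' : in_coset (ra && odd `|1%:Z|%N) q ->
    A q (Y o z%:~R w') = 1 *: Y o z%:~R (A q w')
      + (1 * ratr q) *: Y a (q + (z - 1)%:~R) w'.
  move=> cq; rewrite (cm_commutator_1 mY grd_a go ao _ cq (@coset_even 0 z isT)).
  by rewrite mul1r rmorphB /= addrA.
rewrite (@screenS_commute _ 1 1 (fun i => Y a (srad i + (z - 1)%:~R))
  (fun i => Y a (- srad i + (z - 1)%:~R))).
- rewrite -[RHS]addr0 -[in RHS](kernel_sum_omega (z - 1) w0) scale1r; congr (_ + _).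
  by apply: eq_fsbigr => i _; rewrite scale1r.
- exact: (cm_linear_r mY).
- by rewrite mulr1.
- by move=> i; apply: Y0.
- exact: srad_fin_supp.
- by move=> i w'; apply: cm; apply: coset_srad.
- move=> i w'; rewrite cm; last exact: coset_sradN.
  by rewrite rmorphN mulrN !scaleNr.
Qed.

(** a_0 commutes with e^c_0 because a_0 e^c = 0, and with S because it anticommutes with both modes
    of a in each term. *)
Lemma kernel_screenG w : A 0 w = 0 -> A 0 (screenG w) = 0.
Proof.
move=> w0.
have [ra1|ra0] : ra \/ ra = false by case: (ra); [left | right].
  exact: mode_a0.
have c0 : in_coset (ra && odd `|1%:Z|%N) 0.
  by rewrite ra0; apply/in_cosetP; exists 0; rewrite mul0r addr0.
rewrite /screenG (linB (cm_linear_r mY a 0)).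
rewrite (cm_commutator_m0 mY grd_a grd_ec w c0 (@coset_even 2 0 isT)).
rewrite w0 Y0 scaler0 aec0 (cm0l mY) addr0 sub0r.
rewrite -(@screenS_supercommute (A 0) (-1)).
- by rewrite w0 (lin0 screenS_linear) oppr0.
- exact: (cm_linear_r mY).
- by rewrite mulrNN mulr1.
- by move=> q w' cq; rewrite mode_a_anticommute // scaleN1r.
Qed.

Lemma commutes_screen_lin x u v :
  commutes_screen u -> commutes_screen v -> commutes_screen (x *: u + v).
Proof.
move=> Pu Pv q w w0; have [u0 Gu] := Pu q w w0; have [v0 Gv] := Pv q w w0.
rewrite !(cm_linear_l mY); split.
  by rewrite (cm_linear_r mY) u0 v0 scaler0 addr0.
by rewrite screenG_linear Gu Gv.
Qed.

Lemma commutes_screen_vac : commutes_screen (vsa_vac V).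
Proof. by move=> q w w0; rewrite !(cm_vac mY); case: ifP; rewrite ?Y0 ?screenG0. Qed.

Lemma commutes_screen_prod pu pv puv u n v :
  grd 0 pu u -> grd 0 pv v -> grd 0 puv (vsa_prod u n v) ->
  commutes_screen u -> commutes_screen v -> commutes_screen (vsa_prod u n v).
Proof.
move=> gu gv guv Pu Pv q w w0; case: (in_coset_false q) => [[z ->]|nz]; last first.
  have v0 w' : Y (vsa_prod u n v) q w' = 0.
    by apply: (even_coset_nonint _ guv) => // /asboolP/in_coset_false.
  by rewrite !v0 Y0 screenG0.
have c0 : in_coset (ra && odd `|0%:Z|%N) 0 by apply: (coset_even 0).
have tr w' : exists N, forall j, (N <= j)%N ->
    Y v (z%:~R + j%:R) w' = 0 /\ Y u j%:R w' = 0.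
  have [N HN] := cm_fin_supp mY v z%:~R w'; have [N' HN'] := cm_fin_supp mY u 0 w'.
  exists (maxn N N') => j; rewrite geq_max => /andP[le le'].
  by rewrite HN // -[j%:R]add0r HN'.
(* A bound valid for both w and G w gives two sums of equal length, compared term by term. *)
have [N Nw] := tr w; have [N' NGw] := tr (screenG w); pose K := maxn N N'.
have E w' : (forall j, (K <= j)%N -> Y v (z%:~R + j%:R) w' = 0 /\ Y u j%:R w' = 0) ->
  Y (vsa_prod u n v) z%:~R w' = \sum_(j < K)
    ((-1) ^+ j * gbinom (n%:~R : F) j) *:
      (Y u (n%:~R - j%:R) (Y v (z%:~R + j%:R) w')
       - ((-1) ^+ (pu && pv) * (-1) ^ n) *: Y v (n%:~R + z%:~R - j%:R) (Y u j%:R w')).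
  move=> Kw; rewrite (cm_product mY gu gv n w' c0 (@coset_even 0 z isT)).
  apply: fsum_nat_trunc => j /Kw[-> ->].
  by rewrite !Y0 scaler0 subrr scaler0.
rewrite (E w) => [|j]; last by rewrite geq_max => /andP[le _]; apply: Nw.
rewrite (E (screenG w)) => [|j]; last by rewrite geq_max => /andP[_]; apply: NGw.
rewrite (lin_sum (cm_linear_r mY a 0)) (lin_sum screenG_linear).
split; [rewrite big1 // => j _|apply: eq_bigr => j _].
  have [u0 _] := Pu j%:R w w0; have [v0 _] := Pv (z%:~R + j%:R) w w0.
  rewrite (cmZ mY) (linB (cm_linear_r mY a 0)) (cmZ mY).
  have [-> _] := Pu (n%:~R - j%:R) _ v0.
  have [-> _] := Pv (n%:~R + z%:~R - j%:R) _ u0.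
  by rewrite scaler0 subr0 scaler0.
have [u0 Gu] := Pu j%:R w w0; have [v0 Gv] := Pv (z%:~R + j%:R) w w0.
rewrite (linZ screenG_linear) (linB screenG_linear) (linZ screenG_linear).
have [_ ->] := Pu (n%:~R - j%:R) _ v0.
have [_ ->] := Pv (n%:~R + z%:~R - j%:R) _ u0.
by rewrite Gu Gv.
Qed.

End ScreeningOperators.

(** * Both kinds of modules in the common form, and the induction over V^SH *)

Lemma exprN1z (F : fieldType) (k : int) : (-1 : F) ^ k = (-1) ^+ odd `|k|%N.
Proof.
case: k => n; first by rewrite signr_odd.
by rewrite NegzE abszN signr_odd -[RHS]invr_sign.
Qed.

Lemma sigma_graded (F : fieldType) k p (v : PiF2 F) : graded k p v ->
  sigma v = (-1) ^+ odd `|k|%N *: v.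
Proof.
move=> gv.
have vE : (v : {malg F[state]}) = \sum_(s <- msupp v) v@_s *: ket F s.
  apply: etrans (monalgE _) _; apply: eq_bigr => s _; apply/malgP => s'.
  rewrite [LHS]mcoeffU [RHS]mcoeffZ /ket [X in _ * X]mcoeffU.
  by case: (s == s'); rewrite ?mulr1 ?mulr0.
apply: etrans (_ : _ = (-1) ^+ odd `|k|%N *: (\sum_(s <- msupp v) v@_s *: ket F s)) _.
  rewrite scaler_sumr; apply: eq_big_seq => s /gv[<- _].
  by rewrite exprN1z !scalerA mulrC.
exact: (f_equal _ (esym vE)).
Qed.

(** Reading the indices as parities, the right-hand side groups the even part and the odd part of a
    product. *)
Lemma biadditive_sum4 (U V : zmodType) (f : U -> U -> V) (u0 u1 v0 v1 : U) :
  (forall x y z, f (x + y) z = f x z + f y z) ->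
  (forall x y z, f x (y + z) = f x y + f x z) ->
  f (u0 + u1) (v0 + v1) = (f u0 v0 + f u1 v1) + (f u0 v1 + f u1 v0).
Proof. by move=> fl fr; rewrite fl !fr [f u1 v0 + _]addrC addrACA. Qed.

(** Extending integer modes by zero to rational indices lets an untwisted module share the format of
    a twisted one. *)
Definition rat_modes (V : Type) (M : zmodType) (Y : V -> int -> M -> M)
    (v : V) (q : rat) (w : M) : M :=
  if q \is a Num.int then Y v (Num.floor q) w else 0.

Lemma rat_modesE (V : Type) (M : zmodType) (Y : V -> int -> M -> M) v (z : int) w :
  rat_modes Y v z%:~R w = Y v z w.
Proof. by rewrite /rat_modes intr_int intrKfloor. Qed.

Section Assembly.
Variable C : numClosedFieldType.

Lemma coset_module_of_module (M : lmodType C) (Y : PiF2 C -> int -> M -> M) :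
  is_module Y -> coset_module (V := PiF2 C) (@graded C) false (rat_modes Y).
Proof.
pose Y' := rat_modes Y => mY; rewrite -/Y'.
have Y'E v z w : Y' v z%:~R w = Y v z w by exact: rat_modesE.
have cos (q : rat) : in_coset false q -> exists z : int, q = z%:~R.
  by move=> /in_cosetP[z ->]; exists z; rewrite mul0r addr0.
split.
- move=> q w x u v; rewrite /Y' /rat_modes; case: ifP => _; first exact: (module_linear_l mY).
  by rewrite scaler0 addr0.
- move=> v q x u w; rewrite /Y' /rat_modes; case: ifP => _; first exact: (module_linear_r mY).
  by rewrite scaler0 addr0.
- move=> v w; have [N HN] := module_field mY v w; exists N%:~R => q le.
  by rewrite /Y' /rat_modes; case: ifP => // _; apply: HN; rewrite floor_ge_int.
- move=> q w; rewrite /Y' /rat_modes; case: ifP => [/intrP[z ->]|nq].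
    rewrite intrKfloor (module_vac mY).
    have -> // : (z == -1) = (z%:~R == -1 :> rat).
    by rewrite -[LHS](@eqr_int rat) rmorphN1.
  case: eqP => // E; move: nq; rewrite E.
  by rewrite -[-1]/((-1)%:~R) intr_int.
- move=> k p v _ q w nq; rewrite /Y' /rat_modes; case: ifP => // /intrP[z E].
  by case: nq; apply/in_cosetP; exists z; rewrite mul0r addr0.
- move=> k l pu pv u v gu gv m q n w /cos[y ->] /cos[z ->].
  have := module_borcherds mY (graded_par gu) (graded_par gv) y n z w.
  rewrite ratr_int => B; apply: etrans (etrans B _).
    apply: eq_fsbigr => j _; congr (_ *: _).
    by rewrite -Y'E rmorphB rmorphD /= -pmulrn.
  apply: eq_fsbigr => j _; congr (_ *: (_ - _ *: _)).
    rewrite -!Y'E; congr (Y' _ _ (Y' _ _ _)); first by rewrite rmorphB rmorphD /= -pmulrn.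
    by rewrite rmorphD /= -pmulrn.
  rewrite -!Y'E; congr (Y' _ _ (Y' _ _ _)); first by rewrite rmorphB rmorphD /= -pmulrn.
  by rewrite rmorphD /= -pmulrn.
Qed.

Lemma coset_module_of_twisted (M : lmodType C) (Y : PiF2 C -> rat -> M -> M) :
  is_twisted_module (@sigma C) Y -> coset_module (V := PiF2 C) (@graded C) true Y.
Proof.
move=> mY; split.
- exact: (tw_linear_l mY).
- exact: (tw_linear_r mY).
- exact: (tw_field mY).
- exact: (tw_vac mY).
- by move=> k p v gv; apply: (tw_coset mY); apply: sigma_graded gv.
- move=> k l pu pv u v gu gv m q n w cm cq.
  exact: (tw_borcherds mY (graded_par gu) (graded_par gv)
    (sigma_graded gu) (sigma_graded gv)).
Qed.

Section Commutation.
Variables (ra : bool) (M : lmodType C) (Y : PiF2 C -> rat -> M -> M).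
Hypothesis mY : coset_module (V := PiF2 C) (@graded C) ra Y.

Let ga : graded 1 true (vec_a C).
Proof. exact: graded_vec_a. Qed.

Let gb : graded 1 false (vec_b C).
Proof. exact: graded_elat. Qed.

Let gec : graded 2 false (vec_ec C).
Proof. exact: graded_elat. Qed.

Local Notation P := (commutes_screen ra Y (vec_a C) (vec_ec C)).

Lemma VSH_commutes cL cLa v : VSH cL cLa v -> P v.
Proof.
move=> Vv.
(* Elements of V^SH need not have a parity, so the induction carries a decomposition into an even
   and an odd part of charge 0, each commuting with G. *)
have [v0 [v1 [-> _ _ P0 P1]]] : exists v0 v1 : PiF2 C,
    [/\ v = v0 + v1, graded 0 false v0, graded 0 true v1, P v0 & P v1].
  have g0 p : graded 0 p (0 : {malg C[state]}) by apply: supported0.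
  have P0 : P 0.
    move=> q w w0; rewrite !(cm0l mY) (cm0 mY); split=> //.
    by rewrite (lin0 (screenG_linear mY _ _)).
  elim: {v} Vv => [v|| x u v _ [u0 [u1 [-> gu0 gu1 Pu0 Pu1]]]
      _ [v0 [v1 [-> gv0 gv1 Pv0 Pv1]]]
    | u n v _ [u0 [u1 [-> gu0 gu1 Pu0 Pu1]]] _ [v0 [v1 [-> gv0 gv1 Pv0 Pv1]]]].
  - have gA : graded 0 false (vec_alpha cLa) by exact: graded_alpha.
    have gP : graded 0 true (vec_Psi cLa) by exact: graded_Psi.
    have gT : graded 0 true (vec_tau cL) by exact: graded_tau.
    have gO : graded 0 false (vec_omega cL) by exact: graded_omega.
    case=> ->.
    + exists (vec_alpha cLa), 0; split; rewrite ?addr0 //; first exact: g0.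
      apply: (commutes_screen_trivial mY ga gec gA).
        exact: vec_a_prod_alpha.
      exact: vec_ec_prod_alpha.
    + exists 0, (vec_Psi cLa); split; rewrite ?add0r //; first exact: g0.
      apply: (commutes_screen_trivial mY ga gec gP).
        exact: vec_a_prod_Psi.
      exact: vec_ec_prod_Psi.
    + exists 0, (vec_tau cL); split; rewrite ?add0r //; first exact: g0.
      apply: (commutes_screen_tau mY ga gb gec _ gT).
      * exact: vec_a_prod_b.
      * exact: vec_a_prod_tau.
      * apply: etrans (vec_ec_prod_tau cL) _; congr (_ *: _); apply/esym.
        exact: vec_a_prod_b_psiec.
    + exists (vec_omega cL), 0; split; rewrite ?addr0 //; first exact: g0.
      apply: (commutes_screen_omega mY ga gec _ gO).
      * exact: vec_a_prod_a.
      * exact: vec_a_prod_omega.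
      * exact: vec_ec_prod_omega.
  - exists (vsa_vac (PiF2 C)), 0; split.
    + exact: esym (addr0 _).
    + exact: graded_elat.
    + exact: g0.
    + exact: (commutes_screen_vac mY).
    + exact: P0.
  - exists (x *: u0 + v0), (x *: u1 + v1); split.
    + by rewrite scalerDr addrACA.
    + by apply: supportedD => //; apply: supportedZ.
    + by apply: supportedD => //; apply: supportedZ.
    + exact: (commutes_screen_lin mY).
    + exact: (commutes_screen_lin mY).
  - pose pr (y z : PiF2 C) : PiF2 C := vsa_prod y n z.
    have grp p q y z : graded 0 p y -> graded 0 q z -> graded 0 (p (+) q) (pr y z).
      exact: graded_Fock_prod.
    have Pp p q y z : graded 0 p y -> graded 0 q z -> P y -> P z -> P (pr y z).
      move=> gy gz; exact: (commutes_screen_prod mY gy gz (grp _ _ _ _ gy gz)).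
    have PD y z : P y -> P z -> P (y + z).
      by rewrite -{2}[y]scale1r; apply: (commutes_screen_lin mY).
    exists (pr u0 v0 + pr u1 v1), (pr u0 v1 + pr u1 v0); split.
    + apply: (@biadditive_sum4 _ _ pr) => y z t.
        exact: (linD (Fock_prod_linear_l n t) y z).
      exact: (linD (Fock_prod_linear_r y n) z t).
    + by apply: supportedD; [apply: (grp false false)|apply: (grp true true)].
    + by apply: supportedD; [apply: (grp false true)|apply: (grp true false)].
    + by apply: PD; [apply: (Pp false false)|apply: (Pp true true)].
    + by apply: PD; [apply: (Pp false true)|apply: (Pp true false)].
rewrite -[v0]scale1r; exact: (commutes_screen_lin mY).
Qed.

End Commutation.
End Assembly.

Lemma opG_screenG (C : numClosedFieldType) (M : lmodType C)
    (Y : PiF2 C -> int -> M -> M) w :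
  opG Y w = screenG (V := PiF2 C) false (rat_modes Y) (vec_a C) (vec_ec C) w.
Proof.
rewrite /opG /screenG (rat_modesE Y _ 0); congr (_ - _).
(* S is summed from i = 1 while [srad] starts at index 0, hence the reindexing by the successor. *)
rewrite /opS /screenS (_ : [set i : nat | (1 <= i)%N]%classic = (succn @` setT)%classic).
  rewrite fsbig_image; last by move=> x y _ _ [].
  apply: eq_fsbigr => i _.
  have -> : srad false i = (i.+1%:Z)%:~R.
    by rewrite /srad mul0r subr0 -pmulrn -addn1 natrD.
  by rewrite ratr_int -pmulrn -rmorphN !rat_modesE.
by apply/seteqP; split=> [[|i] // _|_ [i _ <-] //]; exists i.
Qed.

Lemma opG_tw_screenG (C : numClosedFieldType) (M : lmodType C)
    (Y : PiF2 C -> rat -> M -> M) w :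
  opG_tw Y w = screenG (V := PiF2 C) true Y (vec_a C) (vec_ec C) w.
Proof.
rewrite /opG_tw /screenG; congr (_ - _); apply: eq_fsbigr => i _.
have -> : srad true i = i%:R + 2%:R^-1 by rewrite /srad /=; lra.
by rewrite rmorphD fmorphV !rmorph_nat opprD.
Qed.

(* With M-bar = Ker_M Q: M-bar is stable under V^SH and under G, and G commutes
   with the action of V^SH on it. *)
Theorem theorem4p1 (R : realType) (cL cLa : R[i]) (hcLa : cLa != 0) :
  (forall (M : lmodType R[i]) (Y : PiF2 R[i] -> int -> M -> M),
     is_module Y ->
     (forall w : M, opQ Y w = 0 -> opQ Y (opG Y w) = 0) /\
     (forall v : PiF2 R[i], VSH cL cLa v -> forall (n : int) (w : M),
        opQ Y w = 0 ->
        opQ Y (Y v n w) = 0 /\ opG Y (Y v n w) = Y v n (opG Y w)))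
  /\
  (forall (M : lmodType R[i]) (Y : PiF2 R[i] -> rat -> M -> M),
     is_twisted_module (@sigma R[i]) Y ->
     forall v : PiF2 R[i], VSH cL cLa v -> forall (q : rat) (w : M),
       opG_tw Y (Y v q w) = Y v q (opG_tw Y w)).
Proof.
split=> M Y mY.
- have mY' := coset_module_of_module mY.
  have ga := graded_vec_a; have ge := graded_elat.
  have K0 w : opQ Y w = 0 -> rat_modes Y (vec_a R[i]) 0 w = 0.
    by move=> w0; apply: etrans (rat_modesE Y _ 0 _) w0.
  split=> [w w0|v Vv n w w0].
    rewrite opG_screenG; apply: etrans (esym (rat_modesE Y _ 0 _)) _.
    apply: (kernel_screenG mY'); last exact: K0.
    - exact: ga.
    - exact: ge.
    - exact: vec_a_prod_a.
    - exact: (vec_a_prod_ec _ 0).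
  have [Kv Gv] := VSH_commutes mY' Vv n%:~R (K0 _ w0).
  rewrite rat_modesE in Kv; rewrite !rat_modesE in Gv; rewrite !opG_screenG.
  by split; [apply: etrans (esym (rat_modesE Y _ 0 _)) Kv | exact: Gv].
- have mY' := coset_module_of_twisted mY.
  move=> v Vv q w; rewrite !opG_tw_screenG.
  have w0 : Y (vec_a R[i]) 0 w = 0 by exact: (mode_a0 mY' (@graded_vec_a _)).
  by have [_] := VSH_commutes mY' Vv q w0.
Qed.
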